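(* Let $\mathcal M\subset\mathbb R^{2n}$, $\Omega$, $G$, $J=-\Omega^{-1}G$, $h$, $Z_h$ be as in the context, and let $K:\mathbb T^n\times\mathbb T^\ell\to\mathcal M$ be a real-analytic map with $L=D_\theta K$ of rank $n$ everywhere, parameterizing an invariant torus with non-resonant frequency vector $(\omega,\alpha)\in\mathbb R^n\times\mathbb R^\ell$, i.e. $$Z_h(K(\theta,\varphi),\varphi)=-\mathfrak L_{\omega,\alpha}K(\theta,\varphi).$$ With $N,\tilde N,T_h$ defined in the context, the torsion matrix $$T(\theta,\varphi)=N(\theta,\varphi)^\top\Omega(K(\theta,\varphi))\big(D_zZ_h(K(\theta,\varphi),\varphi)N(\theta,\varphi)+\mathfrak L_{\omega,\alpha}N(\theta,\varphi)\big)$$ satisfies, for all $(\theta,\varphi)\in\mathbb T^n\times\mathbb T^\ell$, $$T=-\tfrac12\tilde N^\top\big(T_h+T_h^\top\big)\tilde N+\tilde N^\top T_h^\top N+N^\top T_h\tilde N,$$ where $N,\tilde N$ are evaluated at $(\theta,\varphi)$ and $T_h$ at $(K(\theta,\varphi),\varphi)$.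
   Context: $\mathbb T^m=\mathbb R^m/\mathbb Z^m$. $\mathcal M\subset\mathbb R^{2n}$ is open with a real-analytic exact symplectic form $d\boldsymbol\alpha$; if $a(z)$ is the coefficient vector of $\boldsymbol\alpha$, its matrix is $\Omega(z)=(Da(z))^\top-Da(z)$, with $\det\Omega\neq0$. $G$ is the symmetric positive definite real-analytic matrix of a Riemannian metric on $\mathcal M$, and $J=-\Omega^{-1}G$. $h:\mathcal M\times\mathbb T^\ell\to\mathbb R$ is real-analytic and $Z_h(z,\varphi)=\Omega(z)^{-1}(D_zh(z,\varphi))^\top$. $\mathfrak L_{\omega,\alpha}=-\big(\sum_{i=1}^n\omega_i\partial_{\theta_i}+\sum_{j=1}^\ell\alpha_j\partial_{\varphi_j}\big)$. Non-resonant means $k_1\cdot\omega+k_2\cdot\alpha\ne0$ for all $(k_1,k_2)\in\mathbb Z^n\times\mathbb Z^\ell\setminus\{0\}$. With $\Omega,G,J$ evaluated at $K(\theta,\varphi)$: $L=D_\theta K$ ($2n\times n$), $B=(L^\top GL)^{-1}$, $\tilde N=JLB$, $A=-\frac12\tilde N^\top\Omega\tilde N$, $N=LA+\tilde N$. Moreover $$T_h(z,\varphi)=\Omega(z)\big(D_zZ_h(z,\varphi)-D_zJ(z)[Z_h(z,\varphi)]J(z)^{-1}-J(z)D_zZ_h(z,\varphi)J(z)^{-1}\big),$$ where $D_zJ(z)[v]$ is the directional derivative of $J$ at $z$ in direction $v$. *)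

(* Defs.v *)
From HB Require Import structures.
From mathcomp Require Import all_boot all_order all_algebra.
From mathcomp Require Import all_classical all_reals all_analysis.
Set Implicit Arguments.
Unset Strict Implicit.
Unset Printing Implicit Defensive.
Import Order.TTheory GRing.Theory Num.Theory.
Import numFieldNormedType.Exports.
Local Open Scope classical_set_scope.
Local Open Scope ring_scope.

(* Points and vectors are column vectors.  A function on the torus
   T^m = R^m / Z^m is a function on 'cV[R]_m invariant under Z^m; a function on
   a product is curried, and [uncurry_cV] turns it into a function of one
   stacked vector. *)

Definition torus_fun (R : realType) (m : nat) (X : Type) (f : 'cV[R]_m -> X) :=
  forall (x : 'cV[R]_m) (k : 'cV[int]_m), f (x + map_mx intr k) = f x.

Definition uncurry_cV (R : realType) (m p : nat) (X : Type)
  (f : 'cV[R]_m -> 'cV[R]_p -> X) (w : 'cV[R]_(m + p)) : X :=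
  f (usubmx w) (dsubmx w).

Definition basis_cV (R : realType) (m : nat) (i : 'I_m) : 'cV[R]_m :=
  delta_mx i 0.

Definition monomial (R : realType) (m : nat) (e : {ffun 'I_m -> nat})
  (y : 'cV[R]_m) : R := \prod_(i < m) y i 0 ^+ e i.

(* The norm of 'cV[R]_m is the sup norm, so [`|y| < r] is a polydisc.  Partial
   sums are taken over the boxes {0, .., N-1}^m; since the family is absolutely
   summable the order of summation is irrelevant. *)
Definition analytic_at (R : realType) (m : nat) (f : 'cV[R]_m -> R)
  (x : 'cV[R]_m) : Prop :=
  exists (c : {ffun 'I_m -> nat} -> R) (r : R), 0 < r /\
    forall y : 'cV[R]_m, `|y| < r ->
      summable [set: {ffun 'I_m -> nat}] (fun e => (c e * monomial e y)%:E) /\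
      (fun N : nat => \sum_(b : {ffun 'I_m -> 'I_N})
         let e := [ffun i => nat_of_ord (b i)] in c e * monomial e y) @ \oo
        --> f (x + y).

Definition analytic_on (R : realType) (m : nat) (U : set 'cV[R]_m)
  (f : 'cV[R]_m -> R) : Prop := forall x, U x -> analytic_at f x.

Definition mx_analytic_on (R : realType) (m p q : nat) (U : set 'cV[R]_m)
  (F : 'cV[R]_m -> 'M[R]_(p, q)) : Prop :=
  forall i j, analytic_on U (fun x => F x i j).

Fixpoint Ck_on (R : realType) (m k : nat) (U : set 'cV[R]_m)
  (f : 'cV[R]_m -> R) : Prop :=
  (forall x, U x -> {for x, continuous f}) /\
  if k is k'.+1 then
    forall i : 'I_m, (forall x, U x -> derivable f x (basis_cV R i)) /\
                     Ck_on k' U ('D_(basis_cV R i) f)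
  else True.

Definition smooth_on (R : realType) (m : nat) (U : set 'cV[R]_m)
  (f : 'cV[R]_m -> R) : Prop := forall k, Ck_on k U f.

(* Entry (i, j) is the j-th partial derivative of the i-th component: this is
   the transpose of the library's ['J], which acts on row vectors. *)
Definition Dmx (R : realType) (m p : nat) (f : 'cV[R]_m -> 'cV[R]_p)
  (x : 'cV[R]_m) : 'M[R]_(p, m) :=
  \matrix_(i < p, j < m) ('D_(basis_cV R j) f x) i 0.

Definition Drow (R : realType) (m : nat) (f : 'cV[R]_m -> R) (x : 'cV[R]_m) :
  'rV[R]_m := \row_(j < m) 'D_(basis_cV R j) f x.

(* Matrix of the 2-form d(sum_i a_i dz_i). *)
Definition Omega (R : realType) (m : nat) (a : 'cV[R]_m -> 'cV[R]_m)
  (z : 'cV[R]_m) : 'M[R]_m := (Dmx a z)^T - Dmx a z.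

(* 1-forms are smooth; only the 2-form itself is required to be analytic. *)
Definition analytic_exact_symplectic (R : realType) (m : nat)
  (M : set 'cV[R]_m) (a : 'cV[R]_m -> 'cV[R]_m) : Prop :=
  [/\ forall i, smooth_on M (fun z => a z i 0),
      mx_analytic_on M (Omega a) &
      forall z, M z -> \det (Omega a z) != 0].

Definition analytic_metric (R : realType) (m : nat) (M : set 'cV[R]_m)
  (G : 'cV[R]_m -> 'M[R]_m) : Prop :=
  [/\ mx_analytic_on M G,
      forall z, M z -> (G z)^T = G z &
      forall z (v : 'cV[R]_m), M z -> v != 0 -> 0 < (v^T *m G z *m v) 0 0].

Definition Jmx (R : realType) (m : nat) (a : 'cV[R]_m -> 'cV[R]_m)
  (G : 'cV[R]_m -> 'M[R]_m) (z : 'cV[R]_m) : 'M[R]_m :=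
  - (invmx (Omega a z) *m G z).

Definition Zh (R : realType) (m l : nat) (a : 'cV[R]_m -> 'cV[R]_m)
  (h : 'cV[R]_m -> 'cV[R]_l -> R) (z : 'cV[R]_m) (phi : 'cV[R]_l) : 'cV[R]_m :=
  invmx (Omega a z) *m (Drow (h^~ phi) z)^T.

Definition Th (R : realType) (m l : nat) (a : 'cV[R]_m -> 'cV[R]_m)
  (G : 'cV[R]_m -> 'M[R]_m) (h : 'cV[R]_m -> 'cV[R]_l -> R)
  (z : 'cV[R]_m) (phi : 'cV[R]_l) : 'M[R]_m :=
  let J := Jmx a G in
  let DZ := Dmx (Zh a h ^~ phi) z in
  Omega a z *m (DZ - 'D_(Zh a h z phi) J z *m invmx (J z)
                   - J z *m DZ *m invmx (J z)).

Definition Lop (R : realType) (n l p q : nat)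
  (omega : 'cV[R]_n) (alpha : 'cV[R]_l)
  (F : 'cV[R]_n -> 'cV[R]_l -> 'M[R]_(p, q))
  (theta : 'cV[R]_n) (phi : 'cV[R]_l) : 'M[R]_(p, q) :=
  - (\sum_(i < n) omega i 0 *: 'D_(basis_cV R i) (F^~ phi) theta
     + \sum_(j < l) alpha j 0 *: 'D_(basis_cV R j) (F theta) phi).

Definition nonresonant (R : realType) (n l : nat)
  (omega : 'cV[R]_n) (alpha : 'cV[R]_l) : Prop :=
  forall (k1 : 'cV[int]_n) (k2 : 'cV[int]_l), (k1, k2) != (0, 0) ->
    \sum_(i < n) (k1 i 0)%:~R * omega i 0
      + \sum_(j < l) (k2 j 0)%:~R * alpha j 0 != 0.

Section Frame.
Context (R : realType) (n l : nat).
Context (a : 'cV[R]_(2 * n) -> 'cV[R]_(2 * n)).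
Context (G : 'cV[R]_(2 * n) -> 'M[R]_(2 * n)).
Context (K : 'cV[R]_n -> 'cV[R]_l -> 'cV[R]_(2 * n)).
Implicit Types (theta : 'cV[R]_n) (phi : 'cV[R]_l).

Definition Lframe theta phi : 'M[R]_(2 * n, n) := Dmx (K^~ phi) theta.

Definition Bframe theta phi : 'M[R]_n :=
  invmx ((Lframe theta phi)^T *m G (K theta phi) *m Lframe theta phi).

Definition Ntilde theta phi : 'M[R]_(2 * n, n) :=
  Jmx a G (K theta phi) *m Lframe theta phi *m Bframe theta phi.

Definition Aframe theta phi : 'M[R]_n :=
  - (2^-1 *: ((Ntilde theta phi)^T *m Omega a (K theta phi)
                *m Ntilde theta phi)).

Definition Nframe theta phi : 'M[R]_(2 * n, n) :=
  Lframe theta phi *m Aframe theta phi + Ntilde theta phi.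

Definition torsion (h : 'cV[R]_(2 * n) -> 'cV[R]_l -> R)
  (omega : 'cV[R]_n) (alpha : 'cV[R]_l) theta phi : 'M[R]_n :=
  (Nframe theta phi)^T *m Omega a (K theta phi)
    *m (Dmx (Zh a h ^~ phi) (K theta phi) *m Nframe theta phi
        + Lop omega alpha Nframe theta phi).

End Frame.

(* Main.v *)
Require Import Defs.
From HB Require Import structures.
From mathcomp Require Import all_boot all_order all_algebra.
From mathcomp Require Import complex.
From mathcomp Require Import all_classical all_reals all_analysis.
From mathcomp Require Import ring lra zify.
Set Implicit Arguments.
Unset Strict Implicit.
Unset Printing Implicit Defensive.
Import Order.TTheory GRing.Theory Num.Theory.
Import numFieldNormedType.Exports.
Local Open Scope classical_set_scope.
Local Open Scope ring_scope.

(** Write a prime for the derivative along [w = (omega, alpha)], so that [Lop]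
is minus the prime; let [J], [Om] and [T_h] be evaluated on the torus, and let
[S] be the derivative there of the vector field [Zh].

The invariance equation reads [K' = Zh].  Differentiating it in [theta] gives
the linearized flow [L' = S L] ([derive_Lframe_flow]), and since [Om] is closed
and the Hessian of [h] is symmetric, a Hamiltonian field preserves the form:
[Om' = - (S^T Om + Om S)] ([Hamiltonian_preserves_Omega]).  The definitions of
[J] and [B] give [L^T Om Nt = - 1], and differentiating [Nt = J L B] gives

  [Om Nt' = Om S Nt - T_h Nt + Om Nt C],   where [C = B^-1 B'];

so [T_h] measures how far [Nt] is from being carried along by the flow.

The formula is then linear algebra ([torsion_algebra]).  Let
[E = Nt^T T_h Nt].  Substituting [N = L A + Nt] in [S N - N'], the torsion is
[N^T T_h Nt + A C - A'], provided that the torus is isotropic,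
[L^T Om L = 0].  Differentiating [A = - Nt^T Om Nt / 2] gives
[A' = (E - E^T) / 2 + A C + C^T A].  Finally differentiating
[L^T Om Nt = - 1] gives [L^T T_h Nt = - C], so that the remaining term
[- C^T A] is [Nt^T T_h^T L A = Nt^T T_h^T (N - Nt)].

Isotropy is where exactness and nonresonance enter
([invariant_torus_isotropic]).  The two flow equations show that [L^T Om L]
is constant along the flow of [w] on the torus.  The orbits of this flow are
dense, by Kronecker's theorem ([kronecker]), so its entries are constant.  The
form is exact, so these entries are curls [d_i beta_j - d_j beta_i] of periodic
functions, and a constant curl has mean zero, hence vanishes
([torus_curl_const_eq0]).

Kronecker's theorem is proved by comparing a maximum with a mean.  If the orbit
of [w] avoided a ball around [x], then the product of the
[cos (pi (t w_j - x_j)) ^ (2 p)] would be at most [q ^ p] for all [t], with a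
fixed [q < 1]; but the frequencies in its trigonometric expansion vanish only
for the constant term, so that its mean over [t] is the product of the
[binomial(2 p, p) / 4 ^ p], which decays polynomially in [p].

All these derivatives make sense because analytic functions are of class [C^k]
([analytic_on_Ck]: the power series may be differentiated term by term), [C^1]
functions are differentiable ([differentiable_partials]) and second partial
derivatives of [C^2] functions commute ([partials_commute]). *)

(** * Mean value theorems and partial derivatives *)

Lemma mx_entry_le_norm (R : realType) m n (A : 'M[R]_(m, n)) i j : `|A i j| <= `|A|.
Proof.
rewrite [leRHS]/Num.Def.normr/= mx_normrE.
exact: (le_bigmax _ (fun ij => `|A ij.1 ij.2|) (i, j)).
Qed.

Lemma mx_norm_le (R : realType) m n (A : 'M[R]_(m, n)) (e : R) :
  0 <= e -> (forall i j, `|A i j| <= e) -> `|A| <= e.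
Proof.
move=> e0 Ae; rewrite [leLHS]/Num.Def.normr/= mx_normrE.
by apply: bigmax_le => // -[i j] _; exact: Ae.
Qed.

Lemma mx_norm_lt (R : realType) m n (A : 'M[R]_(m, n)) (e : R) :
  0 < e -> (forall i j, `|A i j| < e) -> `|A| < e.
Proof.
move=> e0 Ae; rewrite [ltLHS]/Num.Def.normr/= mx_normrE.
by apply/bigmax_ltP; split=> // -[i j] _; exact: Ae.
Qed.

Lemma cvg_sum (R : numFieldType) (V : normedModType R) (T I : Type)
  (F : set_system T) (r : seq I) (f : I -> T -> V) (l : I -> V) :
  Filter F -> (forall i, f i @ F --> l i) ->
  (fun t => \sum_(i <- r) f i t) @ F --> \sum_(i <- r) l i.
Proof.
move=> FF fl; elim: r => [|i r IH].
  rewrite big_nil (_ : (fun _ => _) = cst 0); first exact: cvg_cst.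
  by apply/funext => t; rewrite big_nil.
rewrite big_cons (_ : (fun _ => _) = fun t => f i t + \sum_(j <- r) f j t).
  exact: cvgD.
by apply/funext => t; rewrite big_cons.
Qed.

Section DirectionalMVT.
Context (R : realType) (V : normedModType R).
Implicit Types (f : V -> R) (x v : V).

Lemma is_derive_line f x v (s : R) : derivable f (x + s *: v) v ->
  is_derive s 1 (fun t : R => f (x + t *: v)) ('D_v f (x + s *: v)).
Proof.
move=> df.
have E : (fun h : R => h^-1 *: (f (h *: v + (x + s *: v)) - f (x + s *: v)))
  = (fun h : R => h^-1 *: (f (x + (h *: 1 + s) *: v) - f (x + s *: v))).
  apply/funext => h; congr (_ *: (f _ - _)).
  by rewrite [h *: 1]mulr1 scalerDl addrCA.
apply: DeriveDef; first by move: df; rewrite /derivable E.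
by rewrite /derive E.
Qed.

(** Both signs of [h] are allowed, which spares case distinctions in each
coordinate below. *)
Lemma mvt_line f x v (h : R) :
  (forall s : R, `|s| <= `|h| -> derivable f (x + s *: v) v) ->
  exists2 s, `|s| <= `|h| & f (x + h *: v) - f x = h * 'D_v f (x + s *: v).
Proof.
move=> df; pose g (t : R) := f (x + t *: v).
have dg (s : R) : `|s| <= `|h| -> is_derive s 1 g ('D_v f (x + s *: v)).
  by move=> /df; exact: is_derive_line.
have g0 : g 0 = f x by rewrite /g scale0r addr0.
have [h0|h0] := leP 0 h.
  have inb s : s \in `[0, h]%R -> `|s| <= `|h|.
    by rewrite in_itv/= => /andP[s0 sh]; rewrite !ger0_norm.
  have [s /inb sh Es] : exists2 c, c \in `[0, h]%R &
      g h - g 0 = 'D_v f (x + c *: v) * (h - 0).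
    apply: MVT_segment => // [s sI|].
      by apply: dg; apply: inb; exact: subset_itv_oo_cc.
    by apply: derivable_within_continuous => s /inb /dg [].
  by exists s => //; rewrite -g0 -/(g h) Es subr0 mulrC.
have inb s : s \in `[h, 0]%R -> `|s| <= `|h|.
  by rewrite in_itv/= => /andP[s0 sh]; rewrite !ler0_norm ?lerN2// ltW.
have [s /inb sh Es] : exists2 c, c \in `[h, 0]%R &
    g 0 - g h = 'D_v f (x + c *: v) * (0 - h).
  apply: MVT_segment => // [|s sI|]; first exact: ltW.
    by apply: dg; apply: inb; exact: subset_itv_oo_cc.
  by apply: derivable_within_continuous => s /inb /dg [].
exists s => //; apply: oppr_inj.
by rewrite -g0 -/(g h) opprB Es sub0r mulrN mulrC.
Qed.

End DirectionalMVT.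

Section PartialDerivatives.
Context (R : realType) (m : nat).
Implicit Types (f : 'cV[R]_m -> R) (x y : 'cV[R]_m) (U : set 'cV[R]_m).

(** Walk from [x] to [x + y] one coordinate at a time.  In the sup norm the
intermediate points are no farther from [x] than [x + y]. *)
Lemma mvt_coordinates f x y :
  (forall z, `|z - x| <= `|y| -> forall i, derivable f z (basis_cV R i)) ->
  exists xi : 'I_m -> 'cV[R]_m, (forall i, `|xi i - x| <= `|y|) /\
    f (x + y) - f x = \sum_i y i 0 * 'D_(basis_cV R i) f (xi i).
Proof.
move=> df.
(* [p k] already has the first [k] coordinates of the end point. *)
pose p (k : nat) : 'cV[R]_m := x + \col_i (if (i < k)%N then y i 0 else 0).
have step (i : 'I_m) : exists2 z, `|z - x| <= `|y| &
    f (p i.+1) - f (p i) = y i 0 * 'D_(basis_cV R i) f z.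
  have pn (s : R) : `|s| <= `|y i 0| -> `|p i + s *: basis_cV R i - x| <= `|y|.
    move=> sy; rewrite /p addrAC [x + _]addrC addrK.
    apply: mx_norm_le => // j k; rewrite ord1 !mxE eqxx andbT.
    case: (eqVneq j i) => [->|ji].
      rewrite ltnn add0r mulr1; apply: le_trans sy _; exact: mx_entry_le_norm.
    rewrite mulr0 addr0; case: ifP => _; first exact: mx_entry_le_norm.
    by rewrite normr0.
  have -> : p i.+1 = p i + y i 0 *: basis_cV R i.
    rewrite /p -addrA; congr (_ + _); apply/matrixP => j k.
    rewrite !mxE ord1 eqxx andbT ltnS leq_eqVlt.
    case: (eqVneq j i) => [->|ji]; first by rewrite eqxx ltnn mulr1 add0r.
    by rewrite (negbTE (_ : nat_of_ord j != i))//= mulr0 addr0.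
  have [s sy ->] := mvt_line (fun s sy => df _ (pn s sy) i).
  by exists (p i + s *: basis_cV R i) => //; exact: pn.
have /choice[xi Hxi] : forall i : 'I_m, exists z, `|z - x| <= `|y| /\
    f (p i.+1) - f (p i) = y i 0 * 'D_(basis_cV R i) f z.
  by move=> i; have [z ? ?] := step i; exists z.
exists xi; split=> [i|]; first by have [] := Hxi i.
have pm : x + y = p m.
  by congr (_ + _); apply/matrixP => i j; rewrite !mxE ord1 ltn_ord.
have p0 : x = p 0%N.
  by rewrite -[LHS]addr0; congr (_ + _); apply/matrixP => i j; rewrite !mxE.
rewrite pm [X in _ - f X]p0.
rewrite -(@telescope_sumr _ 0 m (fun k => f (p k)))// big_mkord.
by apply: eq_bigr => i _; have [] := Hxi i.
Qed.

(** The candidate differential is the linear form given by the partial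
derivatives; the coordinatewise mean value theorem turns the increment of [f]
into partial derivatives at nearby points. *)
Lemma differentiable_partials U f x : open U -> U x ->
  (forall z, U z -> forall i, derivable f z (basis_cV R i)) ->
  (forall i, {for x, continuous ('D_(basis_cV R i) f)}) ->
  differentiable f x /\
  forall v, 'D_v f x = \sum_i v i 0 * 'D_(basis_cV R i) f x.
Proof.
move=> Uo Ux df cf.
pose l (v : 'cV[R]_m) := \sum_i v i 0 * 'D_(basis_cV R i) f x.
have ll : linear l.
  move=> k u v; rewrite /l scaler_sumr -big_split/=; apply: eq_bigr => i _.
  by rewrite !mxE mulrDl; congr (_ + _); rewrite -mulrA.
pose lM := GRing.isLinear.Build _ _ _ _ _ ll.
pose L : {linear _ -> _} := HB.pack l lM.
have lc : continuous L.
  move=> v.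
  apply: (@cvg_sum _ _ _ _ (nbhs v) _
    (fun i (u : 'cV[R]_m) => u i 0 * 'D_(basis_cV R i) f x)) => i.
  by apply: cvgM; [exact: coord_continuous|exact: cvg_cst].
have dE (e : {posnum R}) : \forall y \near (0 : 'cV[R]_m),
    `|f (y + x) - (f x + l y)| <= e%:num * `|y|.
    (* The [m] coordinates share the error; [m.+1] avoids dividing by zero. *)
  have m0 : 0 < e%:num / m.+1%:R by rewrite divr_gt0.
  have : \forall z \near x, U z /\ forall i,
      `|'D_(basis_cV R i) f z - 'D_(basis_cV R i) f x| <= e%:num / m.+1%:R.
    near=> z; split; first by near: z; exact: open_nbhs_nbhs.
    near: z; apply: filter_forall => i.
    apply: (@cvgr_distC_le R R _ (nbhs x) _ _ _ (cf i)); exact: m0.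
  move=> /nbhs_ballP[d /= d0 dU]; near=> y.
  have yd : `|y| < d.
    by near: y; apply/nbhs_ballP; exists d => //= u; rewrite -ball_normE/= sub0r normrN.
  have inU z : `|z - x| <= `|y| -> ball x d z.
    by move=> zy; rewrite -ball_normE/= distrC; exact: le_lt_trans yd.
  have [z /inU/dU[Uz _]|xi [xin]] := @mvt_coordinates f x y; first exact: df.
  rewrite [y + x]addrC => E; rewrite opprD addrA E /l -sumrB.
  apply: (@le_trans _ _ (\sum_(i < m) `|y| * (e%:num / m.+1%:R))).
    apply: le_trans (ler_norm_sum _ _ _) _; apply: ler_sum => i _.
    rewrite -mulrBr normrM ler_pM//; first exact: mx_entry_le_norm.
    by have [_] := dU _ (inU _ (xin i)); exact.
  rewrite sumr_const card_ord -[leLHS]mulr_natr -mulrA mulrC ler_wpM2r//.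
  by rewrite mulrAC ler_pdivrMr// ler_wpM2l// ler_nat.
have dfE : 'd f x = L :> (_ -> _).
  by apply: diff_unique => //; apply/eqaddoP => _/posnumP[e]; exact: dE.
have fd : differentiable f x.
  apply/diff_locallyP; rewrite dfE; split=> //.
  by apply/eqaddoP => _/posnumP[e]; exact: dE.
by split=> // v; rewrite deriveE// dfE.
Unshelve. all: by end_near. Qed.

(** The left-hand side is symmetric in [i] and [j]: used for both orders, the
lemma compares the two mixed derivatives at points close to [x]. *)
Lemma second_difference f x i j (h : R) :
  (forall z, `|z - x| <= 2 * `|h| -> derivable f z (basis_cV R i)) ->
  (forall z, `|z - x| <= 2 * `|h| ->
    derivable ('D_(basis_cV R i) f) z (basis_cV R j)) ->
  exists2 z, `|z - x| <= 2 * `|h| &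
    f (x + h *: basis_cV R i + h *: basis_cV R j) - f (x + h *: basis_cV R i)
      - (f (x + h *: basis_cV R j) - f x)
    = h * (h * 'D_(basis_cV R j) ('D_(basis_cV R i) f) z).
Proof.
move=> di dj; set ei := basis_cV R i; set ej := basis_cV R j.
have n1 k (s : R) : `|s *: basis_cV R k| <= `|s|.
  apply: mx_norm_le => // a b; rewrite !mxE.
  by case: andP; rewrite ?mulr1// mulr0 normr0.
have n2 (s t : R) : `|s| <= `|h| -> `|t| <= `|h| ->
    `|x + s *: ei + t *: ej - x| <= 2 * `|h|.
  move=> sh th; rewrite addrAC [x + _]addrC addrK.
  by rewrite mulr_natl mulr2n (le_trans (ler_normD _ _))// lerD// (le_trans (n1 _ _ _)).
pose g z := f (z + h *: ej) - f z.
have dsh z : `|z + h *: ej - x| <= 2 * `|h| ->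
    is_derive z ei (fun z => f (z + h *: ej)) ('D_ei f (z + h *: ej)).
  move=> zb; have E : (fun k : R => k^-1 *: (f (k *: ei + (z + h *: ej)) - f (z + h *: ej)))
    = (fun k : R => k^-1 *: (f (k *: ei + z + h *: ej) - f (z + h *: ej))).
    by apply/funext => k; rewrite addrA.
  have := di _ zb; rewrite /derivable E => H.
  by apply: DeriveDef; [|rewrite /derive E].
have [s sh Es] : exists2 s, `|s| <= `|h| & g (x + h *: ei) - g x =
    h * 'D_ei g (x + s *: ei).
  apply: (@mvt_line _ _ g x ei h) => s sh; apply: derivableB.
    by have [] := dsh (x + s *: ei) (n2 _ _ sh (lexx _)).
  by apply: di; have := n2 s 0 sh; rewrite scale0r addr0 normr0; apply.
have [t th Et] : exists2 t, `|t| <= `|h| &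
    'D_ei f (x + s *: ei + h *: ej) - 'D_ei f (x + s *: ei) =
    h * 'D_ej ('D_ei f) (x + s *: ei + t *: ej).
  apply: (@mvt_line _ _ ('D_ei f) (x + s *: ei) ej h) => t th.
  by apply: dj; exact: n2.
exists (x + s *: ei + t *: ej); first exact: n2.
rewrite -Et -[LHS]/(g (x + h *: ei) - g x) Es; congr (_ * _).
have [d1 E1] := dsh (x + s *: ei) (n2 _ _ sh (lexx _)).
have d2 : derivable f (x + s *: ei) ei.
  by apply: di; have := n2 s 0 sh; rewrite scale0r addr0 normr0; apply.
by rewrite (deriveB d1 d2) E1.
Qed.

Lemma close_values_absurd (a b c d : R) : c = d -> `|b - c| < `|a - b| / 3 ->
  `|a - d| < `|a - b| / 3 -> 0 < `|a - b| / 3 -> False.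
Proof.
move=> <-; have := ler_distD c a b; rewrite [in X in X -> _](distrC c b).
by lra.
Qed.

Lemma partials_commute U f x i j : open U -> U x -> Ck_on 2 U f ->
  'D_(basis_cV R i) ('D_(basis_cV R j) f) x =
  'D_(basis_cV R j) ('D_(basis_cV R i) f) x.
Proof.
move=> Uo Ux [_ Cf].
have [di [_ Ci]] := Cf i; have [dj [_ Cj]] := Cf j.
have [dij [cij _]] := Ci j; have [dji [cji _]] := Cj i.
apply/eqP; rewrite -subr_eq0 -normr_eq0; apply/negPn/negP => ne.
set A := 'D_(basis_cV R i) ('D_(basis_cV R j) f).
set B := 'D_(basis_cV R j) ('D_(basis_cV R i) f).
have e0 : 0 < `|A x - B x| / 3 by rewrite divr_gt0// lt_neqAle eq_sym ne normr_ge0.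
have : \forall z \near x, [/\ U z, `|A x - A z| < `|A x - B x| / 3
    & `|B x - B z| < `|A x - B x| / 3].
  have NU : \forall z \near x, U z by exact: open_nbhs_nbhs.
  have cA : {for x, continuous A} by exact: cji.
  have cB : {for x, continuous B} by exact: cij.
  have NA : \forall z \near x, `|A x - A z| < `|A x - B x| / 3.
    exact: (cvgr_dist_lt A (A x) cA).
  have NB : \forall z \near x, `|B x - B z| < `|A x - B x| / 3.
    exact: (cvgr_dist_lt B (B x) cB).
  move: NU NA NB; apply: filterS3 => z ? ? ?; split; assumption.
move=> /nbhs_ballP[d /= d0 dU].
have inU z : `|z - x| <= 2 * `|d / 4| -> ball x d z.
  rewrite -ball_normE/= distrC => /le_lt_trans; apply.
  by rewrite ger0_norm; lra.
have [z zx Ez] := @second_difference f x i j (d / 4)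
  (fun z zx => di z (let: And3 u _ _ := dU _ (inU _ zx) in u))
  (fun z zx => dij z (let: And3 u _ _ := dU _ (inU _ zx) in u)).
have [w wx Ew] := @second_difference f x j i (d / 4)
  (fun z zx => dj z (let: And3 u _ _ := dU _ (inU _ zx) in u))
  (fun z zx => dji z (let: And3 u _ _ := dU _ (inU _ zx) in u)).
have E : B z = A w.
  have d4 : d / 4 != 0 by rewrite gt_eqF// divr_gt0.
  have sym (u v w' t : R) : u - v - (w' - t) = u - w' - (v - t) by ring.
  apply: (mulfI d4); apply: (mulfI d4); apply: etrans (esym Ez) (etrans _ Ew).
  by rewrite -[x + _ + _]addrA (addrC (_ *: _)) addrA; exact: sym.
have [_ _ Bz] := dU _ (inU _ zx); have [_ Aw _] := dU _ (inU _ wx).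
exact: close_values_absurd E Bz Aw e0.
Unshelve. all: by end_near. Qed.

End PartialDerivatives.

(** * Differentiating matrix-valued functions *)

Section MatrixCalculus.
Context (R : realType) (V : normedModType R).
Implicit Types (x v : V).

Lemma differentiable_big_sum (W : normedModType R) I (r : seq I) (f : I -> V -> W) x :
  (forall i, differentiable (f i) x) ->
  differentiable (fun y => \sum_(i <- r) f i y) x.
Proof.
move=> df; elim: r => [|i r IH].
  rewrite (_ : (fun _ => _) = cst 0); first exact: differentiable_cst.
  by apply/funext => y; rewrite big_nil.
rewrite (_ : (fun _ => _) = f i + (fun y => \sum_(j <- r) f j y)).
  exact: differentiableD.
by apply/funext => y; rewrite big_cons.
Qed.

(** The difference of the two functions vanishes near [x], so it has
differential zero. *)
Lemma near_eq_differentiable (W : normedModType R) (f g : V -> W) x :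
  (\forall y \near x, f y = g y) -> differentiable f x -> differentiable g x.
Proof.
move=> fg df; rewrite (_ : g = f + (g - f)); last first.
  by apply/funext => y; rewrite !fctE addrC subrK.
apply: differentiableD => //.
have zc : continuous (\0 : {linear V -> W}) by move=> ?; exact: cvg_cst.
have fgx := nbhs_singleton fg.
have fg0 : \forall y \near (0 : V), f (y + x) = g (y + x).
  by move: fg; rewrite (near_shift 0 x) subr0.
have E e : 0 < e -> \forall y \near (0 : V),
    `|((g - f) \o shift x - (cst ((g - f) x) + (\0 : {linear V -> W}))) y|
      <= e * `|y|.
  move=> e0; near=> y; rewrite !fctE /= -fgx subrr addr0 subr0.
  have -> : f (y + x) = g (y + x).
    by near: y.
  by rewrite subrr normr0 mulr_ge0// ltW.
apply/diff_locallyP.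
have -> : 'd (g - f) x = (\0 : {linear V -> W}) :> (V -> W).
  by apply: diff_unique => //; apply/eqaddoP => e; exact: E.
by split=> //; apply/eqaddoP => e; exact: E.
Unshelve. all: by end_near. Qed.

Lemma derive_big_sum (W : normedModType R) I (r : seq I) (f : I -> V -> W) x v :
  (forall i, differentiable (f i) x) ->
  'D_v (fun y => \sum_(i <- r) f i y) x = \sum_(i <- r) 'D_v (f i) x.
Proof.
move=> df; elim: r => [|i r IH].
  rewrite (_ : (fun _ => _) = cst 0); first by rewrite derive_cst big_nil.
  by apply/funext => y; rewrite big_nil.
rewrite (_ : (fun _ => _) = f i + (fun y => \sum_(j <- r) f j y)).
  rewrite deriveD; [|exact: diff_derivable|].
    by rewrite big_cons IH.
  exact/diff_derivable/differentiable_big_sum.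
by apply/funext => y; rewrite big_cons.
Qed.

Lemma differentiable_mul (f g : V -> R) x :
  differentiable f x -> differentiable g x ->
  differentiable (fun y => f y * g y) x.
Proof. exact: differentiableM. Qed.

Lemma derive_mul (f g : V -> R) x v :
  differentiable f x -> differentiable g x ->
  'D_v (fun y => f y * g y) x = 'D_v f x * g x + f x * 'D_v g x.
Proof.
move=> /diff_derivable df /diff_derivable dg.
by rewrite -[LHS]/('D_v (f * g) x) deriveM// addrC [g x *: _]mulrC.
Qed.

Lemma differentiable_big_prod I (r : seq I) (f : I -> V -> R) x :
  (forall i, differentiable (f i) x) ->
  differentiable (fun y => \prod_(i <- r) f i y) x.
Proof.
move=> df; elim: r => [|i r IH].
  rewrite (_ : (fun _ => _) = cst 1); first exact: differentiable_cst.
  by apply/funext => y; rewrite big_nil.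
rewrite (_ : (fun _ => _) = (fun y => f i y * \prod_(j <- r) f j y)).
  exact: differentiable_mul.
by apply/funext => y; rewrite big_cons.
Qed.

Context (p q : nat).

Lemma differentiable_mxP (F : V -> 'M[R]_(p, q)) x :
  differentiable F x <-> forall i j, differentiable (fun y => F y i j) x.
Proof.
split=> [dF i j|dF].
  apply: (@differentiable_comp _ _ _ _ F (fun A : 'M[R]_(p, q) => A i j)) => //.
  exact: differentiable_coord.
rewrite (_ : F = fun y => \sum_i \sum_j F y i j *: delta_mx i j); last first.
  by apply/funext => y; exact: matrix_sum_delta.
apply: differentiable_big_sum => i; apply: differentiable_big_sum => j.
exact: differentiableZl.
Qed.

Lemma derive_mxE (F : V -> 'M[R]_(p, q)) x v i j : differentiable F x ->
  ('D_v F x) i j = 'D_v (fun y => F y i j) x.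
Proof. by move=> dF; rewrite derive_mx ?mxE//; exact: diff_derivable. Qed.

End MatrixCalculus.

Section MatrixProducts.
Context (R : realType) (V : normedModType R).
Implicit Types (x v : V).

Lemma differentiable_mulmx p q r (F : V -> 'M[R]_(p, q)) (G : V -> 'M[R]_(q, r)) x :
  differentiable F x -> differentiable G x ->
  differentiable (fun y => F y *m G y) x.
Proof.
move=> /differentiable_mxP dF /differentiable_mxP dG.
apply/differentiable_mxP => i j.
rewrite (_ : (fun _ => _) = fun y => \sum_k F y i k * G y k j).
  by apply: differentiable_big_sum => k; exact: differentiable_mul.
by apply/funext => y; rewrite mxE.
Qed.

Lemma derive_mulmx p q r (F : V -> 'M[R]_(p, q)) (G : V -> 'M[R]_(q, r)) x v :
  differentiable F x -> differentiable G x ->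
  'D_v (fun y => F y *m G y) x = 'D_v F x *m G x + F x *m 'D_v G x.
Proof.
move=> dF dG; have dFG := differentiable_mulmx dF dG.
have /differentiable_mxP dF' := dF; have /differentiable_mxP dG' := dG.
apply/matrixP => i j; rewrite derive_mxE// !mxE -big_split/=.
rewrite (_ : (fun _ => _) = fun y => \sum_k F y i k * G y k j); last first.
  by apply/funext => y; rewrite mxE.
rewrite derive_big_sum => [|k]; last exact: differentiable_mul.
apply: eq_bigr => k _; rewrite derive_mul//.
by rewrite (derive_mxE _ _ _ dF) (derive_mxE _ _ _ dG).
Qed.

Lemma differentiable_trmx p q (F : V -> 'M[R]_(p, q)) x :
  differentiable F x -> differentiable (fun y => (F y)^T) x.
Proof.
move=> /differentiable_mxP dF; apply/differentiable_mxP => i j.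
by rewrite (_ : (fun _ => _) = fun y => F y j i)//; apply/funext => y; rewrite mxE.
Qed.

Lemma derive_trmx p q (F : V -> 'M[R]_(p, q)) x v :
  differentiable F x -> 'D_v (fun y => (F y)^T) x = ('D_v F x)^T.
Proof.
move=> dF; apply/matrixP => i j; rewrite derive_mxE; last exact: differentiable_trmx.
rewrite mxE derive_mxE//; congr ('D_v _ x).
by apply/funext => y; rewrite mxE.
Qed.

Lemma differentiable_det p (F : V -> 'M[R]_p) x :
  differentiable F x -> differentiable (fun y => \det (F y)) x.
Proof.
move=> /differentiable_mxP dF.
apply: differentiable_big_sum => s.
apply: differentiable_mul; first exact: differentiable_cst.
exact: differentiable_big_prod.
Qed.

(** By Cramer's rule the entries are quotients of determinants; this describes
[invmx] only at invertible matrices, whence the neighbourhood. *)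
Lemma differentiable_invmx p (F : V -> 'M[R]_p) x :
  (\forall y \near x, F y \in unitmx) ->
  differentiable F x -> differentiable (fun y => invmx (F y)) x.
Proof.
move=> uF dF; apply/differentiable_mxP => i j.
have ux := nbhs_singleton uF.
have dG : differentiable
    (fun y => (\det (F y))^-1 * ((-1) ^+ (j + i) * \det (row' j (col' i (F y))))) x.
  apply: differentiable_mul.
    apply: differentiableV; first exact: differentiable_det.
    by move: ux; rewrite unitmxE unitfE.
  apply: differentiable_mul; first exact: differentiable_cst.
  apply: differentiable_det; apply/differentiable_mxP => k l.
  move/differentiable_mxP in dF.
  rewrite (_ : (fun _ => _) = fun y => F y (lift j k) (lift i l)) //.
  by apply/funext => y; rewrite !mxE.
move: dG; apply: near_eq_differentiable.
near=> y; rewrite /invmx ifT ?mxE//.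
by near: y.
Unshelve. all: by end_near. Qed.

End MatrixProducts.

(** * Power series are smooth *)

Lemma near_eq_on (T : topologicalType) (X : Type) (U : set T) (f g : T -> X) x :
  open U -> U x -> (forall y, U y -> f y = g y) -> \forall y \near x, f y = g y.
Proof.
by move=> Uo Ux fg; apply: filterS (open_nbhs_nbhs (conj Uo Ux)) => y /fg.
Qed.

Section CkLocal.
Context (R : realType) (m : nat).
Implicit Types (f g : 'cV[R]_m -> R) (U W : set 'cV[R]_m).

Lemma continuous_near_eq f g x :
  (\forall y \near x, f y = g y) -> {for x, continuous f} ->
  {for x, continuous g}.
Proof.
move=> fg cf; have fgx := nbhs_singleton fg.
suff : g @ x --> f x by rewrite fgx.
apply: cvg_trans cf.
have : {near x, f =1 g} by exact: fg.
by move/near_eq_cvg.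
Qed.

Lemma Ck_on_eq k U f g : open U -> (forall y, U y -> f y = g y) ->
  Ck_on k U f -> Ck_on k U g.
Proof.
elim: k f g => [|k IH] f g Uo fg [cf Cf]; split.
- by move=> x Ux; apply: continuous_near_eq (near_eq_on Uo Ux fg) (cf _ Ux).
- by [].
- by move=> x Ux; apply: continuous_near_eq (near_eq_on Uo Ux fg) (cf _ Ux).
- move=> i; have [df Ci] := Cf i; split=> [x Ux|].
    exact: (near_eq_derivable (near_eq_on Uo Ux fg)) (df _ Ux).
  apply: IH Ci => // y Uy.
  exact: near_eq_derive (near_eq_on Uo Uy fg).
Qed.

(** Being of class [C^k] only involves germs. *)
Lemma Ck_on_local k U f :
  (forall x, U x -> exists2 W, W x & Ck_on k W f) -> Ck_on k U f.
Proof.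
elim: k f => [|k IH] f loc.
  by split=> // x /loc[W Wx [cf _]]; exact: cf.
split=> [x /loc[W Wx [cf _]]|i]; first exact: cf.
split=> [x /loc[W Wx [_ /(_ i)[df _]]]|]; first exact: df.
by apply: IH => x /loc[W Wx [_ /(_ i)[_ Ci]]]; exists W.
Qed.

End CkLocal.

(** Reduces a directional derivative to a derivative on the line when only one
factor varies along [v]. *)
Lemma is_derive_along (R : realType) (V : normedModType R) (f : V -> R) (x v : V)
    (g : R -> R) (t C g' : R) :
  (forall h, f (h *: v + x) = C * g (h + t)) -> is_derive t 1 g g' ->
  is_derive x v f (C * g').
Proof.
move=> fg [dg <-].
have E : (fun h : R => h^-1 *: (f (h *: v + x) - f x)) =
         (fun h : R => C *: (h^-1 *: (g (h *: 1 + t) - g t))).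
  apply/funext => h.
  have fx : f x = C * g t by have := fg 0; rewrite scale0r !add0r.
  by rewrite fg fx -mulrBr [h *: 1]mulr1 !scalerA mulrC -scalerA.
have cg : (fun h : R => C *: (h^-1 *: (g (h *: 1 + t) - g t))) @ 0^' --> C * 'D_1 g t.
  by apply: cvgM; [exact: cvg_cst|exact: dg].
apply: DeriveDef; first by rewrite /derivable E; apply/cvg_ex; exists (C * 'D_1 g t).
by rewrite /derive E; exact/cvg_lim.
Qed.

Section MonomialDerivatives.
Context (R : realType) (m : nat).
Implicit Types (d e : 'I_m -> nat) (y : 'cV[R]_m).

(** The partial derivative of multi-order [d] of the monomial [e].  The falling
factorial vanishes when [d i] exceeds [e i], so the truncated subtraction in
the exponent is harmless. *)
Definition dmonomial d e y : R :=
  \prod_(i < m) (((e i) ^_ (d i))%:R * y i 0 ^+ (e i - d i)).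

Definition incr d (i : 'I_m) : 'I_m -> nat := fun j => (d j + (j == i))%N.

Lemma is_derive_dmonomial d e y i :
  is_derive y (basis_cV R i) (dmonomial d e) (dmonomial (incr d i) e y).
Proof.
pose C := (\prod_(j < m | j != i) (((e j) ^_ (d j))%:R * y j 0 ^+ (e j - d j)))
  * ((e i) ^_ (d i))%:R : R.
have -> : dmonomial (incr d i) e y = C * ((e i - d i)%:R * y i 0 ^+ (e i - d i).-1).
  rewrite /dmonomial (bigD1 i)//= /incr eqxx addn1 ffactnSr subnS natrM.
  rewrite (eq_bigr (fun j => ((e j) ^_ (d j))%:R * y j 0 ^+ (e j - d j))).
    by rewrite /C; ring.
  by move=> j /negbTE ->; rewrite addn0.
have dX : is_derive (y i 0) 1 (@GRing.exp R ^~ (e i - d i)%N)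
    ((e i - d i)%:R * y i 0 ^+ (e i - d i).-1).
  apply: DeriveDef; first exact: exprn_derivable.
  by rewrite exp_derive -[LHS]/(_ * _) mulr1.
apply: (is_derive_along _ dX) => h.
rewrite /dmonomial (bigD1 i)//= !mxE !eqxx mulr1.
rewrite (eq_bigr (fun j => ((e j) ^_ (d j))%:R * y j 0 ^+ (e j - d j))).
  by rewrite /C; ring.
by move=> j /negbTE ji; rewrite !mxE ji mulr0 add0r.
Qed.

(** Cauchy's estimate, read off the [d]-th term of the binomial expansion of
[(rho + delta) ^ e]. *)
Lemma ffact_expr_le (rho delta : R) (e d : nat) : 0 <= rho -> 0 < delta ->
  (e ^_ d)%:R * rho ^+ (e - d) <= d`!%:R / delta ^+ d * (rho + delta) ^+ e.
Proof.
move=> r0 d0; have [de|ed] := leqP d e; last first.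
  rewrite ffact_small// mul0r mulr_ge0// ?exprn_ge0 ?addr_ge0//; last exact: ltW.
  by rewrite divr_ge0// exprn_ge0// ltW.
rewrite exprDn -bin_ffact natrM.
rewrite [X in X * rho ^+ _]mulrC -!mulrA ler_wpM2l// ler_pdivlMl ?exprn_gt0//.
rewrite (bigD1 (Ordinal (de : (d < e.+1)%N)))//=.
rewrite mulrC -mulrA mulr_natl lerDl; apply: sumr_ge0 => i _.
by rewrite mulrn_wge0// mulr_ge0// exprn_ge0// ltW.
Qed.

Lemma dmonomial_bound (rho delta : R) d e y : 0 <= rho -> 0 < delta ->
  `|y| <= rho ->
  `|dmonomial d e y| <= (\prod_(i < m) ((d i)`!%:R / delta ^+ d i))
                        * \prod_(i < m) (rho + delta) ^+ e i.
Proof.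
move=> r0 d0 yr; rewrite -big_split/= /dmonomial normr_prod.
apply: ler_prod => i _; rewrite normr_ge0/=.
apply: le_trans (ffact_expr_le (e i) (d i) r0 d0).
rewrite normrM normr_nat ler_wpM2l// normrX lerXn2r ?nnegrE//.
exact: le_trans (mx_entry_le_norm _ _ _) yr.
Qed.

End MonomialDerivatives.

Section BoxSums.
Context (R : realType) (m : nat).
Implicit Types (F : {ffun 'I_m -> nat} -> R).

Definition ffun_nat N (b : {ffun 'I_m -> 'I_N}) : {ffun 'I_m -> nat} :=
  [ffun i => nat_of_ord (b i)].

(** The exhaustion of the multi-indices by which [analytic_at] sums a power
series. *)
Definition box_sum F (N : nat) : R := \sum_(b : {ffun 'I_m -> 'I_N}) F (ffun_nat b).

Lemma ffun_nat_inj N : injective (@ffun_nat N).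
Proof.
move=> b c /ffunP bc; apply/ffunP => i; apply/val_inj.
by have := bc i; rewrite !ffunE.
Qed.

(** The multi-indices of the smaller box are those of the larger one with all
entries below [N]. *)
Lemma box_sumS F N : box_sum F N.+1 = box_sum F N +
  \sum_(b : {ffun 'I_m -> 'I_N.+1} | ~~ [forall i, (b i < N)%N]) F (ffun_nat b).
Proof.
rewrite /box_sum (bigID (fun b : {ffun 'I_m -> 'I_N.+1} => [forall i, (b i < N)%N]))/=.
congr (_ + _).
pose h (b : {ffun 'I_m -> 'I_N}) : {ffun 'I_m -> 'I_N.+1} :=
  [ffun i => widen_ord (leqnSn N) (b i)].
have hE b : ffun_nat (h b) = ffun_nat b by apply/ffunP => i; rewrite !ffunE.
have hinj : injective h.
  by move=> b c bc; apply: ffun_nat_inj; rewrite -hE bc hE.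
rewrite (eq_bigl (mem (h @: [set: {ffun 'I_m -> 'I_N}])%SET)); last first.
  move=> b; apply/forallP/imsetP => [bN|[c _ ->] i]; last by rewrite ffunE /= ltn_ord.
  exists ([ffun i => Ordinal (bN i)] : {ffun 'I_m -> 'I_N}); first by rewrite finset.in_setT.
  rewrite /h.
  by apply/ffunP => i; rewrite !ffunE; apply/val_inj.
rewrite big_imset/=; last by move=> b c _ _; exact: hinj.
rewrite big_mkcond/=; apply: eq_bigr => b _; rewrite hE.
by rewrite finset.in_setT.
Qed.

Lemma box_sum_ge0 F N : (forall e, 0 <= F e) -> 0 <= box_sum F N.
Proof. by move=> F0; exact: sumr_ge0. Qed.

Lemma box_sum_norm F (w : {ffun 'I_m -> nat} -> R) C A N :
  (forall e, `|F e| <= C * w e) -> 0 <= C -> box_sum w N <= A ->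
  `|box_sum F N| <= C * A.
Proof.
move=> Fw C0 wA; apply: le_trans (ler_norm_sum _ _ _) _.
apply: le_trans (ler_wpM2l C0 wA); rewrite mulr_sumr.
by apply: ler_sum => b _; exact: Fw.
Qed.

(** Box sums are the partial sums of the series of their increments, which
converges absolutely when the family is dominated. *)
Lemma box_sum_cvg F (w : {ffun 'I_m -> nat} -> R) C A :
  (forall e, `|F e| <= C * w e) -> (forall e, 0 <= w e) -> 0 <= C ->
  (forall N, box_sum w N <= A) -> cvgn (box_sum F).
Proof.
move=> Fw w0 C0 wA.
pose u N := box_sum F N.+1 - box_sum F N.
pose v N := C * (box_sum w N.+1 - box_sum w N).
have uv N : `|u N| <= v N.
  rewrite /u /v !box_sumS ![_ + \sum_(_ | _) _ - _]addrAC !subrr !add0r.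
  apply: le_trans (ler_norm_sum _ _ _) _; rewrite mulr_sumr.
  by apply: ler_sum => b _; exact: Fw.
have cv : cvgn (series v).
  apply: nondecreasing_is_cvgn.
    by apply: nondecreasing_series => N _ _; apply: le_trans (uv N).
  exists (C * A) => _ [N _ <-]; rewrite /series/= -mulr_sumr ler_wpM2l//.
  rewrite telescope_sumr// lerBlDr (le_trans (wA N))// lerDl.
  exact: box_sum_ge0.
have cu : cvgn (series u).
  apply: normed_cvg; apply: series_le_cvg cv => //= N.
  by apply: le_trans (uv N).
rewrite (_ : box_sum F = fun N => series u N + box_sum F 0); last first.
  by apply/funext => N; rewrite /series/= telescope_sumr// subrK.
by apply: is_cvgD => //; exact: is_cvg_cst.
Qed.

Lemma summable_box_sum F :
  summable [set: {ffun 'I_m -> nat}] (fun e => (F e)%:E) ->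
  exists A, forall N, box_sum (fun e => `|F e|) N <= A.
Proof.
move=> sF; exists (fine (\esum_(e in [set: {ffun 'I_m -> nat}]) `|(F e)%:E|%E)) => N.
rewrite -lee_fin fineK; last first.
  by rewrite -summableE.
apply: esum_ge; exists [set` [seq ffun_nat b | b : {ffun 'I_m -> 'I_N}]].
  by split=> //; exact: finite_seq.
rewrite -fsbig_seq; last by rewrite map_inj_uniq ?enum_uniq//; exact: ffun_nat_inj.
by rewrite big_map -sumEFin big_enum.
Qed.

End BoxSums.

Lemma cvgn_norm_le (R : realType) (u : R^nat) (a B : R) :
  u @ \oo --> a -> (forall N, `|u N| <= B) -> `|a| <= B.
Proof.
move=> /cvg_norm ua uB.
have cB : closed (fun x : R => x <= B) by exact: closed_le.
apply: (@closed_cvg _ _ _ _ _ _ cB _ _ ua).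
by apply: nearW => N; exact: uB.
Qed.

(** A power series whose absolute box sums on the polydisc of radius [2 rho] are
bounded by [A] may be differentiated term by term, any number of times, on
the polydisc of radius [rho]: Cauchy's estimates bound the [d]-th derivatives
of the partial sums by [C d * A]. *)
Section PowerSeries.
Context (R : realType) (m : nat).
Variables (c : {ffun 'I_m -> nat} -> R) (rho A : R).
Let w (e : {ffun 'I_m -> nat}) : R := `|c e| * \prod_(i < m) (rho + rho) ^+ e i.
Hypotheses (rho_gt0 : 0 < rho) (wA : forall N, box_sum w N <= A).
Implicit Types (d : 'I_m -> nat) (y : 'cV[R]_m).

Let C d : R := \prod_(i < m) ((d i)`!%:R / rho ^+ d i).

Let C_ge0 d : 0 <= C d.
Proof.
by apply: prodr_ge0 => i _; rewrite divr_ge0// exprn_ge0// ltW.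
Qed.

Let w_ge0 e : 0 <= w e.
Proof.
rewrite mulr_ge0//; apply: prodr_ge0 => i _.
by rewrite exprn_ge0// addr_ge0// ltW.
Qed.

Let partial_sum d N y : R := box_sum (fun e => c e * dmonomial d e y) N.
Let total d y : R := limn (fun N => partial_sum d N y).

Let term_le d e y : `|y| <= rho -> `|c e * dmonomial d e y| <= C d * w e.
Proof.
move=> yr; rewrite normrM /w mulrCA ler_wpM2l//.
exact: dmonomial_bound (ltW _) _ _.
Qed.

Let A_ge0 : 0 <= A.
Proof. by apply: le_trans (wA 0); exact: box_sum_ge0. Qed.

Let partial_sum_le d N y : `|y| <= rho -> `|partial_sum d N y| <= C d * A.
Proof. by move=> yr; apply: box_sum_norm (wA N) => // e; exact: term_le. Qed.

Let partial_sum_cvg d y : `|y| <= rho ->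
  (fun N => partial_sum d N y) @ \oo --> total d y.
Proof.
by move=> yr; apply: (box_sum_cvg _ w_ge0 (C_ge0 d) wA) => e; exact: term_le.
Qed.

Let total_le d y : `|y| <= rho -> `|total d y| <= C d * A.
Proof.
move=> yr; apply: (cvgn_norm_le (partial_sum_cvg yr)) => N.
exact: partial_sum_le.
Qed.

Let is_derive_partial_sum d N y i : is_derive y (basis_cV R i)
  (partial_sum d N) (partial_sum (incr d i) N y).
Proof.
have dm (b : {ffun 'I_m -> 'I_N}) :
    differentiable (fun z => c (ffun_nat b) * dmonomial d (ffun_nat b) z) y.
  apply: differentiable_mul; first exact: differentiable_cst.
  apply: differentiable_big_prod => j; apply: differentiable_mul.
    exact: differentiable_cst.
  apply: (@differentiable_comp _ _ _ _ (fun z : 'cV[R]_m => z j 0)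
    (@GRing.exp R ^~ (ffun_nat b j - d j)%N)); first exact: differentiable_coord.
  exact/derivable1_diffP/exprn_derivable.
apply: DeriveDef.
  by apply: diff_derivable; exact: differentiable_big_sum.
rewrite [LHS]derive_big_sum//; apply: eq_bigr => b _.
have [df dE] := is_derive_dmonomial d (ffun_nat b) y i.
rewrite -[LHS]/('D_(basis_cV R i) (c (ffun_nat b) *: dmonomial d (ffun_nat b)) y).
by rewrite deriveZ// dE.
Qed.

(** Second order Taylor estimate for the partial sums, uniform in the number of
terms, so that it passes to the limit. *)
Let total_taylor d y i (t : R) : `|y| + `|t| <= rho ->
  `|total d (y + t *: basis_cV R i) - total d y - t * total (incr d i) y|
    <= t ^+ 2 * (C (incr (incr d i) i) * A).
Proof.
move=> yt.
have shift_le (s : R) : `|s| <= `|t| -> `|y + s *: basis_cV R i| <= rho.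
  move=> st; apply: le_trans (ler_normD _ _) (le_trans _ yt).
  rewrite lerD2l normrZ; apply: le_trans st.
  rewrite ler_piMr// mx_norm_le// => j k; rewrite mxE.
  by case: andP; rewrite ?normr1// normr0.
have y_le : `|y| <= rho by apply: le_trans yt; rewrite lerDl.
have psE e N z : derivable (partial_sum e N) z (basis_cV R i) /\
    'D_(basis_cV R i) (partial_sum e N) z = partial_sum (incr e i) N z.
  by have [] := is_derive_partial_sum e N z i.
have est N : `|partial_sum d N (y + t *: basis_cV R i) - partial_sum d N y
     - t * partial_sum (incr d i) N y| <= t ^+ 2 * (C (incr (incr d i) i) * A).
  have [s st ->] := mvt_line (fun s _ => (psE d N (y + s *: basis_cV R i)).1) (h := t).
  rewrite (psE _ _ _).2 -mulrBr.
  have [s' ss' ->] := mvt_line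
    (fun s' _ => (psE (incr d i) N (y + s' *: basis_cV R i)).1) (h := s).
  rewrite (psE _ _ _).2 !normrM mulrA -[t ^+ 2]real_normK ?num_real//.
  apply: ler_pM => //.
    by rewrite expr2 ler_wpM2l.
  by apply: partial_sum_le; apply: shift_le; exact: le_trans st.
apply: (cvgn_norm_le _ est); apply: cvgB; first apply: cvgB.
- by apply: partial_sum_cvg; exact: shift_le.
- exact: partial_sum_cvg.
- by apply: cvgM; [exact: cvg_cst|exact: partial_sum_cvg].
Qed.

Let is_derive_total d y i : `|y| < rho ->
  is_derive y (basis_cV R i) (total d) (total (incr d i) y).
Proof.
move=> yr; pose B := C (incr (incr d i) i) * A.
have B0 : 0 <= B by rewrite mulr_ge0.
have lim0 : (fun h : R => h^-1 *: (total d (h *: basis_cV R i + y) - total d y))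
    @ 0^' --> total (incr d i) y.
  apply/cvgrPdist_le => e e0; near=> h.
  have h0 : h != 0 by near: h; exact: nbhs_dnbhs_neq.
  have hn : 0 < `|h| by rewrite normr_gt0.
  have hr : `|h| <= rho - `|y|.
    near: h; apply: dnbhs0_le; first by rewrite subr_gt0.
  have hB : `|h| <= e / (B + 1).
    near: h; apply: dnbhs0_le; first by rewrite divr_gt0// ltr_wpDl.
  rewrite -(ler_pM2l hn) -normrM mulrBr -[_ *: _]/(_ * _) mulVKf// distrC.
  rewrite [_ + y]addrC; apply: le_trans (total_taylor _ _ _) _.
    by rewrite -lerBrDl.
  rewrite -/B -real_normK ?num_real// expr2 -mulrA ler_wpM2l//.
  apply: le_trans (ler_wpM2r B0 hB) _.
  rewrite mulrAC -mulrA ger_pMr// ler_pdivrMr ?mul1r ?lerDl//.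
  by rewrite ltr_wpDl.
apply: DeriveDef; first by apply/cvg_ex; exists (total (incr d i) y).
exact/cvg_lim.
Unshelve. all: by end_near. Qed.

Let continuous_total d y : `|y| < rho -> {for y, continuous (total d)}.
Proof.
move=> yr; pose B := \sum_(i < m) C (incr d i) * A.
have B0 : 0 <= B by apply: sumr_ge0 => i _; rewrite mulr_ge0.
apply/(@cvgrPdist_le _ _ _ (nbhs y)) => e e0; near=> z.
have zy : `|z - y| < rho - `|y|.
  rewrite distrC; near: z; apply: cvgr_dist_lt; first exact: cvg_id.
  by rewrite subr_gt0.
have zB : `|z - y| <= e / (B + 1).
  rewrite distrC; near: z; apply: cvgr_dist_le; first exact: cvg_id.
  by rewrite divr_gt0// ltr_wpDl.
have inr u : `|u - y| <= `|z - y| -> `|u| < rho.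
  move=> uz; rewrite -[u](subrK y) (le_lt_trans (ler_normD _ _))//.
  by rewrite -ltrBrDr (le_lt_trans uz).
have [u /inr ur i|xi [xin]] := @mvt_coordinates _ _ (total d) y (z - y).
  by have [] := is_derive_total d i ur.
rewrite [y + _]addrC subrK distrC => ->.
apply: (@le_trans _ _ (\sum_(i < m) `|z - y| * (C (incr d i) * A))).
  apply: le_trans (ler_norm_sum _ _ _) _; apply: ler_sum => i _.
  rewrite normrM ler_pM//; first exact: mx_entry_le_norm.
  have [_ ->] := is_derive_total d i (inr _ (xin i)).
  by apply: total_le; apply: ltW; exact: inr (xin i).
rewrite -mulr_sumr -/B; apply: le_trans (ler_wpM2r B0 zB) _.
rewrite mulrAC -mulrA ger_pMr// ler_pdivrMr ?mul1r ?lerDl//.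
by rewrite ltr_wpDl.
Unshelve. all: by end_near. Qed.

(** All derivatives are again sums of the same kind, so induction on [k] applies
with [d] varying. *)
Let Ck_total k d (x : 'cV[R]_m) :
  Ck_on k (ball x rho) (fun z : 'cV[R]_m => total d (z - x)).
Proof.
have inb (z : 'cV[R]_m) : ball x rho z -> `|z - x| < rho.
  by rewrite -ball_normE/= distrC.
have ct e (z : 'cV[R]_m) : ball x rho z ->
    {for z, continuous (fun z : 'cV[R]_m => total e (z - x))}.
  move=> /inb zr.
  have sc : {for z, continuous (fun u : 'cV[R]_m => u - x)}.
    by apply: (@cvgB _ _ _ (nbhs z)); [exact: cvg_id|exact: cvg_cst].
  exact: (continuous_comp sc (continuous_total zr)).
have dt e i (z : 'cV[R]_m) : ball x rho z -> is_derive z (basis_cV R i)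
    (fun z : 'cV[R]_m => total e (z - x)) (total (incr e i) (z - x)).
  move=> /inb zr; have [dtz tE] := is_derive_total e i zr.
  have E : (fun h : R => h^-1 *: (total e (h *: basis_cV R i + (z - x)) - total e (z - x)))
    = (fun h : R => h^-1 *: (total e (h *: basis_cV R i + z - x) - total e (z - x))).
    by apply/funext => h; rewrite addrA.
  apply: DeriveDef; first by move: dtz; rewrite /derivable E.
  by rewrite -tE /derive E.
elim: k d => [|k IH] d; first by split=> // z zb; exact: ct.
split=> [z zb|i]; first exact: ct.
split=> [z /(dt d i)[] //|].
apply: Ck_on_eq (IH (incr d i)); first exact: ball_open.
by move=> z /(dt d i)[].
Qed.

Lemma power_series_Ck k (x : 'cV[R]_m) (f : 'cV[R]_m -> R) :
  (forall y, `|y| < rho ->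
    box_sum (fun e => c e * monomial e y) N @[N --> \oo] --> f (x + y)) ->
  Ck_on k (ball x rho) f.
Proof.
move=> fE; apply: Ck_on_eq (Ck_total k (fun=> 0%N) x); first exact: ball_open.
move=> z; rewrite -ball_normE/= distrC => zr.
have := fE _ zr; rewrite [x + _]addrC subrK => fz; apply: cvg_unique fz => //.
suff -> : (fun N => box_sum (fun e => c e * monomial e (z - x)) N) =
    (fun N => partial_sum (fun=> 0%N) N (z - x)).
  by apply: partial_sum_cvg; exact: ltW.
apply/funext => N; apply: eq_bigr => b _; congr (_ * _).
by apply: eq_bigr => i _; rewrite ffactn0 mul1r subn0.
Qed.

End PowerSeries.

(** Absolute convergence at the single point with all coordinates [r / 2] gives
the uniform bound. *)
Theorem analytic_on_Ck (R : realType) m (U : set 'cV[R]_m) (f : 'cV[R]_m -> R) k :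
  analytic_on U f -> Ck_on k U f.
Proof.
move=> fan; apply: Ck_on_local => x /fan[c [r [r0 fE]]].
have r4 : 0 < r / 4 by rewrite divr_gt0.
pose y0 : 'cV[R]_m := const_mx (r / 4 + r / 4).
have y0r : `|y0| < r.
  apply: (@le_lt_trans _ _ (r / 4 + r / 4)); last lra.
  apply: mx_norm_le => [|i j]; first lra.
  by rewrite mxE ger0_norm//; lra.
have [A wA] := summable_box_sum (fE _ y0r).1.
exists (ball x (r / 4)); first exact: ballxx.
apply: (@power_series_Ck R m c (r / 4) A r4) => [N|y yr].
  apply: le_trans (wA N); apply: ler_sum => b _; rewrite normrM ler_wpM2l//.
  rewrite /monomial normr_prod; apply: ler_prod => i _.
  rewrite normrX mxE [`|_ + _|]ger0_norm; last lra.
  by rewrite lexx exprn_ge0//; lra.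
have yr' : `|y| < r by apply: lt_trans yr _; lra.
exact: (fE _ yr').2.
Qed.

(** * Density of nonresonant orbits in the torus *)

Section CosinePowers.
Context (R : realType).

Let ei (x : R) : R[i] := Complex (cos x) (sin x).

Let eiD x y : ei (x + y) = ei x * ei y.
Proof.
rewrite /ei cosD sinD; apply/eqP; rewrite eq_complex /=.
by rewrite eqxx/= addrC eqxx.
Qed.

Let ei0 : ei 0 = 1.
Proof. by rewrite /ei cos0 sin0. Qed.

Let eiX x n : ei x ^+ n = ei (n%:R * x).
Proof.
by elim: n => [|n IH]; rewrite ?mul0r ?ei0// exprS IH -eiD -natr1 mulrDl mul1r addrC.
Qed.

Let eiN x : ei x + ei (- x) = ((cos x) *+ 2)%:C%C.
Proof.
by rewrite /ei cosN sinN; apply/eqP; rewrite eq_complex /= subrr mulr2n !eqxx.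
Qed.

Let Re_sum (I : finType) (f : I -> R[i]) : complex.Re (\sum_i f i) = \sum_i complex.Re (f i).
Proof. exact: raddf_sum. Qed.

Let Re_real (a : R) (z : R[i]) : complex.Re (a%:C%C * z) = a * complex.Re z.
Proof. by case: z => b c /=; rewrite mul0r subr0. Qed.

Let ei_sum (I : finType) (f : I -> R) : \prod_i ei (f i) = ei (\sum_i f i).
Proof. by rewrite (big_morph ei eiD ei0). Qed.

(** The binomial expansion of [(ei x + ei (- x)) ^+ (2 * p)], multiplied over
the index set; the real parts are taken at the end. *)
Lemma cos_even_power_expand (I : finType) (p : nat) (phi : I -> R) :
  \prod_i cos (phi i) ^+ (2 * p) =
  \sum_(r : {ffun I -> 'I_(2 * p).+1})
    (\prod_i ('C(2 * p, r i)%:R / 4 ^+ p))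
    * cos (\sum_i (p%:Z - (r i)%:Z)%:~R * (2 * phi i)).
Proof.
have one x : ((cos x ^+ (2 * p))%:C)%C = \sum_(r < (2 * p).+1)
    (('C(2 * p, r)%:R / 4 ^+ p)%:C)%C * ei ((p%:Z - r%:Z)%:~R * (2 * x)).
  have -> : cos x ^+ (2 * p) = ((cos x *+ 2) ^+ (2 * p)) / 4 ^+ p.
    rewrite -[_ *+ 2]mulr_natr exprMn [2 ^+ _]exprM -natrX -[(2 ^ 2)%N]/4%N.
    by rewrite mulfK// expf_neq0// pnatr_eq0.
  rewrite rmorphM/= rmorphXn/= -eiN exprDn mulr_suml; apply: eq_bigr => r _.
  rewrite !eiX -eiD rmorphM/=.
  have rp : (r <= 2 * p)%N by rewrite -ltnS.
  have -> : (p%:Z - r%:Z)%:~R * (2 * x) = (2 * p - r)%:R * x + r%:R * - x :> R.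
    by rewrite natrB// natrM rmorphB/= -!pmulrn; ring.
  have -> : ('C(2 * p, r)%:R : R)%:C%C = 'C(2 * p, r)%:R :> R[i] by rewrite rmorph_nat.
  by rewrite -[_ *+ 'C(_, _)]mulr_natr; ring.
suff : ((\prod_i cos (phi i) ^+ (2 * p))%:C)%C = \sum_(r : {ffun I -> 'I_(2 * p).+1})
    (\prod_i ('C(2 * p, r i)%:R / 4 ^+ p))%:C%C
    * ei (\sum_i (p%:Z - (r i)%:Z)%:~R * (2 * phi i)).
  move=> /(congr1 (@complex.Re R)) /= ->; rewrite Re_sum.
  by apply: eq_bigr => r _; rewrite Re_real.
rewrite rmorph_prod/= (eq_bigr _ (fun i _ => one (phi i))) bigA_distr_bigA/=.
by apply: eq_bigr => r _; rewrite big_split/= ei_sum rmorph_prod.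
Qed.

(** Induction through [(p + 1) 'C(2 p + 2, p + 1) = 2 (2 p + 1) 'C(2 p, p)]. *)
Lemma central_bin_lower (p : nat) : (4 ^ p <= (2 * p).+1 * 'C(2 * p, p))%N.
Proof.
elim: p => [|p IH]; first by rewrite muln0 bin0.
have E : (p.+1 * 'C(2 * p.+1, p.+1) = 2 * (2 * p).+1 * 'C(2 * p, p))%N.
  have e1 := mul_bin_diag (2 * p).+2 p.
  have e2 := mul_bin_down (2 * p).+1 p.
  rewrite /= in e1 e2; have -> : (2 * p.+1 = (2 * p).+2)%N by lia.
  rewrite -e1; have e3 : ((2 * p).+1 - p = p.+1)%N by lia.
  rewrite e3 in e2; nia.
rewrite -(leq_pmul2l (ltn0Sn p)) expnS.
have -> : (p.+1 * ((2 * p.+1).+1 * 'C(2 * p.+1, p.+1)) =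
  (2 * p.+1).+1 * (p.+1 * 'C(2 * p.+1, p.+1)))%N by lia.
rewrite E; move: IH; set a := (4 ^ p)%N; set b := 'C(_, _); nia.
Qed.

End CosinePowers.

Section MeanValues.
Context (R : realType).
Implicit Types (f g : R -> R) (c : R).

(** A bounded primitive of [f - c] forces the averages of [f] over long intervals
to tend to [c]; in this form mean values need no integrals. *)
Definition has_mean f c := exists (Q : R -> R) (B : R),
  (forall t : R, is_derive t 1 Q (f t - c)) /\ (forall t, `|Q t| <= B).

Lemma has_mean_const c : has_mean (fun=> c) c.
Proof.
exists (cst 0), 0; split=> [t|t]; last by rewrite normr0.
by rewrite subrr; exact: is_derive_cst.
Qed.

Lemma has_meanD f g c d : has_mean f c -> has_mean g d ->
  has_mean (fun t => f t + g t) (c + d).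
Proof.
move=> [Q [B [Qf QB]]] [S [D [Sg SD]]]; exists (Q + S), (B + D); split=> t.
  by apply: is_derive_eq; ring.
by apply: le_trans (ler_normD _ _) _; exact: lerD.
Qed.

Lemma has_meanM a f c : has_mean f c -> has_mean (fun t => a * f t) (a * c).
Proof.
move=> [Q [B [Qf QB]]]; exists (a *: Q), (`|a| * B); split=> t.
  by apply: is_derive_eq; rewrite -[LHS]/(_ * _); ring.
by rewrite -[(_ *: _) t]/(_ * _) normrM ler_wpM2l.
Qed.

Lemma has_mean_sum (I : Type) (r : seq I) (f : I -> R -> R) (c : I -> R) :
  (forall i, has_mean (f i) (c i)) ->
  has_mean (fun t => \sum_(i <- r) f i t) (\sum_(i <- r) c i).
Proof.
move=> fc; elim: r => [|i r IH].
  rewrite big_nil (_ : (fun _ => _) = fun=> 0); first exact: has_mean_const.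
  by apply/funext => t; rewrite big_nil.
rewrite big_cons (_ : (fun _ => _) = fun t => f i t + \sum_(j <- r) f j t).
  exact: has_meanD.
by apply/funext => t; rewrite big_cons.
Qed.

Lemma has_mean_cos (lam mu : R) : lam != 0 ->
  has_mean (fun t => cos (lam * t + mu)) 0.
Proof.
move=> l0; exists (fun t => lam^-1 * sin (lam * t + mu)), `|lam^-1|; split=> t.
  apply: is_derive_eq.
  by rewrite subr0 -![_ *: _]/(_ * _); field.
by rewrite normrM ler_piMr// ler_norml sin_geN1 sin_le1.
Qed.

(** Otherwise the bounded function [Q] would decrease at least linearly. *)
Lemma has_mean_le f c B : has_mean f c -> (forall t, f t <= B) -> c <= B.
Proof.
move=> [Q [K [Qf QK]]] fB; rewrite leNgt; apply/negP => Bc.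
have K0 : 0 <= K by apply: le_trans (QK 0).
(* Over a time [T] the decrease [T * (c - B)] exceeds the oscillation [2 * K]. *)
pose T := (2 * K + 1) / (c - B).
have T0 : 0 < T by rewrite divr_gt0 ?subr_gt0// ltr_wpDl// mulr_ge0.
have [s _ E] : exists2 s, s \in `]0, T[%R & Q T - Q 0 = (f s - c) * (T - 0).
  apply: MVT => // t; apply/continuous_subspaceT => u.
  by apply/differentiable_continuous/derivable1_diffP; have [] := Qf u.
have := QK T; have := QK 0; rewrite !ler_norml => /andP[h1 h2] /andP[h3 h4].
have cfs : c - B <= c - f s by rewrite lerD2l lerN2.
have := ler_wpM2l (ltW T0) cfs.
have -> : T * (c - B) = 2 * K + 1 by rewrite /T divfK// gt_eqF// subr_gt0.
move: E; rewrite subr0 mulrC => E.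
have -> : T * (c - f s) = - (T * (f s - c)) by ring.
by rewrite -E => h; move: h h1 h2 h3 h4; lra.
Qed.

End MeanValues.

Section PeriodicCosine.
Context (R : realType).

Lemma cos2DpiM (x : R) (k : int) : cos (x + pi * k%:~R) ^+ 2 = cos x ^+ 2.
Proof.
have sq n (y : R) : cos (y + pi *+ n) ^+ 2 = cos y ^+ 2.
  have -> : cos (y + pi *+ n) = (-1) ^+ n * cos y := alternatingn (@cosDpi R) n y.
  by rewrite exprMn sqrr_sign mul1r.
case: k => n; first by rewrite -pmulrn mulr_natr sq.
by rewrite NegzE mulrNz mulrN -pmulrn mulr_natr -(sq n.+1) subrK.
Qed.

Lemma dist_int_cos (u eps : R) : 0 < eps -> eps < 2^-1 ->
  (forall k : int, eps <= `|u - k%:~R|) ->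
  cos (pi * u) ^+ 2 <= cos (pi * eps) ^+ 2.
Proof.
move=> e0 e2 far; pose k := Num.floor (u + 2^-1); pose v := u - k%:~R.
have vE : u = v + k%:~R by rewrite /v subrK.
have v12 : `|v| <= 2^-1.
  have /andP[h1 h2] := floor_itv (u + 2^-1).
  rewrite intrD in h2.
  by rewrite ler_norml /v /k; apply/andP; split; lra.
have -> : cos (pi * u) ^+ 2 = cos (pi * `|v|) ^+ 2.
  have -> : cos (pi * `|v|) = cos (pi * v).
    by have [v0|v0] := ger0P v; rewrite // mulrN cosN.
  by rewrite vE mulrDr cos2DpiM.
have pi0 : 0 < pi :> R by exact: pi_gt0.
have c0 : 0 <= cos (pi * `|v|).
  apply: cos_ge0_pihalf; apply/andP; split; last by rewrite ler_wpM2l// ltW.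
  by rewrite (@le_trans _ _ 0)// ?oppr_le0 ?divr_ge0// ?mulr_ge0// ltW.
have ev : eps <= `|v| by exact: far.
have le1 (x : R) : 0 <= x -> x <= 2^-1 -> pi * x \in `[0, pi]%R.
  move=> x0 x2; rewrite in_itv/=; apply/andP; split.
    by rewrite mulr_ge0// ltW.
  by rewrite ger_pMr//; lra.
have cle : cos (pi * `|v|) <= cos (pi * eps).
  have m1 := le1 eps (ltW e0) (ltW e2).
  have m2 := le1 `|v| (normr_ge0 v) v12.
  by rewrite leNgt ltr_cos// -leNgt ler_wpM2l// ltW.
by rewrite lerXn2r ?nnegrE//; exact: le_trans cle.
Qed.

End PeriodicCosine.

Lemma bernoulli_le (R : realDomainType) (x : R) n : 0 <= x -> 1 + x *+ n <= (1 + x) ^+ n.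
Proof.
move=> x0; elim: n => [|n IH]; first by rewrite mulr0n addr0.
rewrite exprS; apply: le_trans (ler_wpM2l _ IH); last by rewrite addr_ge0.
have : 0 <= x * x *+ n by rewrite mulrn_wge0// mulr_ge0.
by rewrite mulrS mulrDr mulr1 mulrDl mul1r mulrnAr; lra.
Qed.

(** Taking [p] to be a large multiple of [m + 1] leaves one spare Bernoulli
factor. *)
Lemma exp_beats_poly (R : realType) (q : R) m : 0 < q -> q < 1 ->
  exists p : nat, q ^+ p * (2 * p).+1%:R ^+ m < 1.
Proof.
move=> q0 q1; pose d := q^-1 - 1.
have d0 : 0 < d by rewrite subr_gt0 invf_gt1.
pose K := 2 * m.+1%:R / d + 1.
have K0 : 0 <= K by rewrite addr_ge0// divr_ge0// ?mulr_ge0// ltW.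
pose s := (Num.truncn (K ^+ m / d)).+1.
have sK : K ^+ m < s%:R * d by rewrite -ltr_pdivrMr// truncnS_gt.
pose p := (s * m.+1)%N; exists p.
rewrite mulrC -ltr_pdivlMr ?exprn_gt0// mul1r -exprVn.
have -> : q^-1 = 1 + d by rewrite /d addrC subrK.
have sd0 : 0 <= s%:R * d by rewrite mulr_ge0// ltW.
have ber : 1 + s%:R * d <= (1 + d) ^+ s.
  by rewrite mulr_natl bernoulli_le// ltW.
rewrite exprM; apply: lt_le_trans (_ : (1 + s%:R * d) ^+ m.+1 <= _); last first.
  by rewrite lerXn2r ?nnegrE// ?addr_ge0// exprn_ge0// addr_ge0// ltW.
have lin : (2 * p).+1%:R <= K * (1 + s%:R * d).
  have -> : K * (1 + s%:R * d) = 2 * m.+1%:R / d + 1 + 2 * m.+1%:R * s%:R + s%:R * d.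
    by rewrite /K; field; rewrite gt_eqF.
  have -> : (2 * p).+1%:R = 2 * m.+1%:R * s%:R + 1 :> R.
    by rewrite -natr1 /p !natrM; ring.
  have : 0 <= 2 * m.+1%:R / d by rewrite divr_ge0// ?mulr_ge0// ltW.
  by lra.
apply: le_lt_trans (_ : (K * (1 + s%:R * d)) ^+ m < _).
  by rewrite lerXn2r ?nnegrE// mulr_ge0// addr_ge0.
rewrite exprMn exprS ltr_pM2r ?exprn_gt0//; last by rewrite ltr_pwDl.
by apply: lt_trans sK _; rewrite ltrDr.
Qed.

(** If the orbit stayed at distance [e] from [x + Z^m], then for each [t] some
factor of the kernel [P t] would be at most [q ^+ p], although the mean of [P]
is at least [(2 * p).+1%:R ^- m]. *)
Lemma kronecker (R : realType) m (w x : 'cV[R]_m) (eps : R) : 0 < eps ->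
  (forall k : 'cV[int]_m, k != 0 -> \sum_i (k i 0)%:~R * w i 0 != 0) ->
  exists (t : R) (k : 'cV[int]_m), `|x - (t *: w + map_mx intr k)| < eps.
Proof.
move=> eps0 nonres; apply: contrapT => none.
pose e := Num.min eps 4^-1.
have e0 : 0 < e by rewrite lt_min eps0 invr_gt0 ltr0n.
have e2 : e < 2^-1 by rewrite gt_min; apply/orP; right; lra.
pose u (t : R) (j : 'I_m) := t * w j 0 - x j 0.
have far t : exists j, forall k : int, e <= `|u t j - k%:~R|.
  apply: contrapT => near; apply: none.
  have /choice[k Hk] : forall j, exists k : int, `|u t j - k%:~R| < e.
    move=> j; apply: contrapT => nk; apply: near; exists j => k.
    by rewrite leNgt; apply/negP => uk; apply: nk; exists k.
  exists t, (\col_j - k j).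
  apply: mx_norm_lt => // j z; rewrite ord1.
  have := Hk j; rewrite lt_min => /andP[ue _]; apply: le_lt_trans ue.
  by rewrite !mxE distrC rmorphN /u/= le_eqVlt; apply/orP; left; apply/eqP; congr `|_|; ring.
pose q := cos (pi * e) ^+ 2.
have pi0 : 0 < pi :> R by exact: pi_gt0.
have pe0 : 0 < pi * e by rewrite mulr_gt0.
have pe2 : pi * e < pi / 2 by rewrite ltr_pM2l.
have q0 : 0 < q.
  by rewrite exprn_gt0// cos_gt0_pihalf// pe2 andbT (lt_trans _ pe0)// oppr_lt0 divr_gt0.
have q1 : q < 1.
  rewrite /q cos2sin2 ltrBlDr ltrDl exprn_gt0// sin_gt0_pi// pe0/=.
  by apply: lt_trans pe2 _; lra.
have [p Hp] := exp_beats_poly m q0 q1.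
pose P (t : R) := \prod_j cos (pi * u t j) ^+ (2 * p).
have Pq t : P t <= q ^+ p.
  have [j /(dist_int_cos e0 e2) hj] := far t.
  rewrite /P (bigD1 j)//= exprM -[leRHS]mulr1 ler_pM//.
  - by rewrite exprn_ge0// sqr_ge0.
  - by apply: prodr_ge0 => i _; rewrite exprM exprn_ge0// sqr_ge0.
  - by rewrite lerXn2r ?nnegrE// ?sqr_ge0// ltW.
  apply: prodr_ile1 => i _; rewrite exprM exprn_ge0 ?sqr_ge0//=.
  by rewrite exprn_ile1 ?sqr_ge0// sqr_ge0 cos2sin2 lerBlDr lerDl sqr_ge0.
pose a : R := 'C(2 * p, p)%:R / 4 ^+ p.
pose coef (r : {ffun 'I_m -> 'I_(2 * p).+1}) : R := \prod_i ('C(2 * p, r i)%:R / 4 ^+ p).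
have pp : (p < (2 * p).+1)%N by lia.
(* The only multi-index of the expansion with zero frequency. *)
pose mid : {ffun 'I_m -> 'I_(2 * p).+1} := [ffun=> Ordinal pp].
have Pmean : has_mean P (a ^+ m).
  have -> : P = fun t => \sum_(r : {ffun 'I_m -> 'I_(2 * p).+1}) coef r *
      cos (\sum_i (p%:Z - (r i)%:Z)%:~R * (2 * (pi * u t i))).
    by apply/funext => t; exact: cos_even_power_expand.
  have -> : a ^+ m = \sum_(r : {ffun 'I_m -> 'I_(2 * p).+1}) coef r * (r == mid)%:R.
    rewrite (bigD1 mid)//= big1 ?addr0 ?eqxx ?mulr1; last first.
      by move=> r /negbTE ->; rewrite mulr0.
    rewrite /coef (eq_bigr (fun=> a)) ?prodr_const ?card_ord//.
    by move=> i _; rewrite ffunE.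
  apply: has_mean_sum => r; apply: has_meanM.
  have [->|rm] := eqVneq r mid.
    rewrite (_ : (fun _ => _) = fun=> 1); first exact: has_mean_const.
    apply/funext => t; rewrite big1 ?cos0// => i _.
    by rewrite ffunE /= subrr mul0r.
  pose k : 'cV[int]_m := \col_i (p%:Z - (r i)%:Z).
  pose lam := (2 * pi) * \sum_i (k i 0)%:~R * w i 0.
  pose mu := - ((2 * pi) * \sum_i (k i 0)%:~R * x i 0).
  rewrite (_ : (fun _ => _) = fun t => cos (lam * t + mu)); last first.
    apply/funext => t; congr cos; rewrite /lam /mu -mulrA mulr_suml -mulrBr -sumrB.
    by rewrite mulr_sumr; apply: eq_bigr => i _; rewrite mxE /u; ring.
  apply: has_mean_cos; rewrite mulf_neq0//; first by rewrite gt_eqF// mulr_gt0.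
  apply: nonres; apply: contra rm => /eqP k0; apply/eqP/ffunP => i.
  have /matrixP/(_ i 0) := k0; rewrite !mxE ffunE => h.
  by apply/val_inj/esym/eqP; move/eqP: h; rewrite subr_eq0.
have := has_mean_le Pmean Pq; apply/negP; rewrite -ltNge.
have N0 : 0 < (2 * p).+1%:R :> R by rewrite ltr0n.
have aN : (2 * p).+1%:R^-1 <= a.
  rewrite -[leLHS]mul1r ler_pdivrMr// mulrAC ler_pdivlMr ?exprn_gt0// mul1r.
  by rewrite -natrX -natrM ler_nat mulnC; exact: central_bin_lower.
apply: lt_le_trans (_ : (2 * p).+1%:R^-1 ^+ m <= _); last first.
  by rewrite lerXn2r ?nnegrE ?invr_ge0//; exact: le_trans aN.
by rewrite exprVn -[X in _ < X]mul1r ltr_pdivlMr// exprn_gt0.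
Qed.

(** * Chain rules in coordinates *)

Section CkConsequences.
Context (R : realType) (m : nat).
Implicit Types (f : 'cV[R]_m -> R) (x v : 'cV[R]_m) (U : set 'cV[R]_m).

Lemma C1_differentiable k U f x : open U -> U x -> Ck_on k.+1 U f ->
  differentiable f x /\ forall v, 'D_v f x = \sum_i v i 0 * 'D_(basis_cV R i) f x.
Proof.
move=> Uo Ux [_ Cf]; apply: (differentiable_partials Uo Ux).
  by move=> z Uz i; have [df _] := Cf i; exact: df.
by move=> i; have [_ Ci] := Cf i; case: k Ci Cf => [|k] [ci _] _; exact: (ci _ Ux).
Qed.

Lemma C1_partial_continuous k U f x i : U x -> Ck_on k.+1 U f ->
  {for x, continuous ('D_(basis_cV R i) f)}.
Proof.
by move=> Ux [_ /(_ i)[_ Ci]]; case: k Ci => [|k] [ci _]; exact: (ci _ Ux).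
Qed.

(** Near [x] the directional derivative is a combination of partial ones. *)
Lemma directional_partial_commute U f x v i : open U -> U x -> Ck_on 2 U f ->
  'D_v ('D_(basis_cV R i) f) x = 'D_(basis_cV R i) ('D_v f) x.
Proof.
move=> Uo Ux Cf; have [_ Cp] := Cf.
have dp j : differentiable ('D_(basis_cV R j) f) x.
  by have [_ Cj] := Cp j; have [] := C1_differentiable (k := 0) Uo Ux Cj.
have E : \forall y \near x,
    \sum_j v j 0 * 'D_(basis_cV R j) f y = 'D_v f y.
  by apply: (near_eq_on Uo Ux) => y Uy; have [_ ->] := C1_differentiable (k := 1) Uo Uy Cf.
rewrite -(near_eq_derive _ E) derive_big_sum; last first.
  by move=> j; apply: differentiable_mul => //; exact: differentiable_cst.
have [_ Ci] := Cp i; have [_ ->] := C1_differentiable (k := 0) Uo Ux Ci.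
apply: eq_bigr => j _.
rewrite (derive_mul _ (differentiable_cst (v j 0) x) (dp j)).
by rewrite derive_cst mul0r add0r (partials_commute _ _ Uo Ux Cf).
Qed.

End CkConsequences.

Lemma derive_comp (R : realType) (U V W : normedModType R) (f : U -> V) (g : V -> W) x v :
  differentiable f x -> differentiable g (f x) ->
  'D_v (g \o f) x = 'D_('D_v f x) g (f x).
Proof.
move=> df dg; rewrite !deriveE//; last exact: differentiable_comp.
by rewrite diff_comp.
Qed.

Lemma cV_sum_basis (R : realType) m (v : 'cV[R]_m) : v = \sum_i v i 0 *: basis_cV R i.
Proof.
by rewrite [LHS]matrix_sum_delta; apply: eq_bigr => i _; rewrite big_ord1.
Qed.

Lemma derive_sum_basis (R : realType) m (W : normedModType R) (f : 'cV[R]_m -> W) x v :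
  differentiable f x -> 'D_v f x = \sum_i v i 0 *: 'D_(basis_cV R i) f x.
Proof.
move=> df; rewrite deriveE// {1}(cV_sum_basis v) linear_sum.
by apply: eq_bigr => i _; rewrite linearZ deriveE.
Qed.

Lemma derive_Dmx (R : realType) m p (f : 'cV[R]_m -> 'cV[R]_p) x v :
  differentiable f x -> 'D_v f x = Dmx f x *m v.
Proof.
move=> df; rewrite derive_sum_basis//; apply/matrixP => i j.
rewrite summxE !mxE ord1; apply: eq_bigr => k _.
by rewrite !mxE mulrC.
Qed.

(** [Lop] and [Lframe] differentiate curried functions in one argument; the
uncurried function turns them into directional derivatives on one space. *)
Section Uncurry.
Context (R : realType) (n l : nat).
Implicit Types (theta : 'cV[R]_n) (phi : 'cV[R]_l).

Lemma derive_uncurry_l (W : normedModType R) (F : 'cV[R]_n -> 'cV[R]_l -> W) theta phi v :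
  'D_v (F^~ phi) theta = 'D_(col_mx v 0) (uncurry_cV F) (col_mx theta phi).
Proof.
have E : (fun h : R => h^-1 *: (F (h *: v + theta) phi - F theta phi)) =
  (fun h : R => h^-1 *: (uncurry_cV F (h *: col_mx v 0 + col_mx theta phi)
                         - uncurry_cV F (col_mx theta phi))).
  apply/funext => h.
  by rewrite /uncurry_cV scale_col_mx add_col_mx scaler0 add0r !col_mxKu !col_mxKd.
by rewrite /derive E.
Qed.

Lemma derive_uncurry_r (W : normedModType R) (F : 'cV[R]_n -> 'cV[R]_l -> W) theta phi v :
  'D_v (F theta) phi = 'D_(col_mx 0 v) (uncurry_cV F) (col_mx theta phi).
Proof.
have E : (fun h : R => h^-1 *: (F theta (h *: v + phi) - F theta phi)) =
  (fun h : R => h^-1 *: (uncurry_cV F (h *: col_mx 0 v + col_mx theta phi)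
                         - uncurry_cV F (col_mx theta phi))).
  apply/funext => h.
  by rewrite /uncurry_cV scale_col_mx add_col_mx scaler0 add0r !col_mxKu !col_mxKd.
by rewrite /derive E.
Qed.

Lemma basis_lshift (i : 'I_n) : basis_cV R (lshift l i) = col_mx (basis_cV R i) 0.
Proof. by rewrite /basis_cV delta_mx_ushift. Qed.

End Uncurry.

(** * Hamiltonian vector fields *)

Section Slices.
Context (R : realType) (m l : nat).
Implicit Types (z : 'cV[R]_m) (phi : 'cV[R]_l).

Lemma differentiable_col_mx phi z :
  differentiable (fun z : 'cV[R]_m => col_mx z phi) z.
Proof.
apply/differentiable_mxP => i j; case: (split_ordP i) => k ->.
  rewrite (_ : (fun _ => _) = fun z : 'cV[R]_m => z k j).
    exact: differentiable_coord.
  by apply/funext => y; rewrite col_mxEu.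
rewrite (_ : (fun _ => _) = cst (phi k j)); first exact: differentiable_cst.
by apply/funext => y; rewrite col_mxEd.
Qed.

Lemma slice_quotient (f : 'cV[R]_(m + l) -> R) phi z i :
  (fun h : R => h^-1 *: (f (col_mx (h *: basis_cV R i + z) phi) - f (col_mx z phi)))
  = (fun h : R => h^-1 *: (f (h *: basis_cV R (lshift l i) + col_mx z phi)
                           - f (col_mx z phi))).
Proof.
apply/funext => h.
by rewrite basis_lshift scale_col_mx add_col_mx scaler0 add0r.
Qed.

Lemma Ck_on_slice k U (f : 'cV[R]_(m + l) -> R) phi : Ck_on k U f ->
  Ck_on k [set z | U (col_mx z phi)] (fun z => f (col_mx z phi)).
Proof.
have cs (g : 'cV[R]_(m + l) -> R) z : {for col_mx z phi, continuous g} ->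
    {for z, continuous (fun z => g (col_mx z phi))}.
  move=> cg.
  exact: (continuous_comp (differentiable_continuous (differentiable_col_mx phi z)) cg).
elim: k f => [|k IH] f [cf Cf]; first by split=> // z Uz; exact/cs/cf.
split=> [z Uz|i]; first exact/cs/cf.
have [df Ci] := Cf (lshift l i); split=> [z /df|].
  by rewrite /derivable slice_quotient.
have -> : 'D_(basis_cV R i) (fun z => f (col_mx z phi)) =
    (fun z => 'D_(basis_cV R (lshift l i)) f (col_mx z phi)).
  by apply/funext => z; rewrite /derive slice_quotient.
exact: (IH _ Ci).
Qed.

End Slices.

Section Symplectic.
Context (R : realType) (m : nat) (M : set 'cV[R]_m) (a : 'cV[R]_m -> 'cV[R]_m).
Hypotheses (M_open : open M) (a_C2 : forall i, Ck_on 2 M (fun z => a z i 0)).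
Implicit Types (z v : 'cV[R]_m).

Lemma C1_potential_differentiable z : M z -> differentiable a z.
Proof.
move=> Mz; apply/differentiable_mxP => i j; rewrite ord1.
by have [] := C1_differentiable (k := 1) M_open Mz (a_C2 i).
Qed.

Lemma OmegaE z i j : M z -> Omega a z i j =
  'D_(basis_cV R i) (fun z => a z j 0) z - 'D_(basis_cV R j) (fun z => a z i 0) z.
Proof.
move=> Mz; have da := C1_potential_differentiable Mz.
have E p q : Dmx a z p q = 'D_(basis_cV R q) (fun z => a z p 0) z.
  by rewrite mxE derive_mxE.
have entry (A B : 'M[R]_m) : (A^T - B) i j = A j i - B i j by rewrite !mxE.
by rewrite /Omega entry E E.
Qed.

Lemma Omega_antisym z : (Omega a z)^T = - Omega a z.
Proof. by rewrite /Omega linearB/= trmxK opprB. Qed.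

Let partial_differentiable z i j : M z ->
  differentiable ('D_(basis_cV R i) (fun z => a z j 0)) z.
Proof.
move=> Mz; have [_ /(_ i)[_ Ci]] := a_C2 j.
by have [] := C1_differentiable (k := 0) M_open Mz Ci.
Qed.

Let Omega_near z i j : M z -> \forall y \near z,
  ('D_(basis_cV R i) (fun z => a z j 0) - 'D_(basis_cV R j) (fun z => a z i 0)) y
  = Omega a y i j.
Proof. by move=> Mz; apply: (near_eq_on M_open Mz) => y My; rewrite OmegaE. Qed.

Lemma differentiable_Omega z : M z -> differentiable (Omega a) z.
Proof.
move=> Mz; apply/differentiable_mxP => i j.
apply: near_eq_differentiable (Omega_near i j Mz) _.
by apply: differentiableB; exact: partial_differentiable.
Qed.

Lemma derive_Omega z v i j : M z -> ('D_v (Omega a) z) i j =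
  'D_v ('D_(basis_cV R i) (fun z => a z j 0)) z
  - 'D_v ('D_(basis_cV R j) (fun z => a z i 0)) z.
Proof.
move=> Mz; rewrite derive_mxE; last exact: differentiable_Omega.
rewrite -(near_eq_derive _ (Omega_near i j Mz)) deriveB//;
  exact/diff_derivable/partial_differentiable.
Qed.

(** The form is closed because second derivatives of the potential commute. *)
Lemma Omega_closed z i j k : M z ->
  ('D_(basis_cV R k) (Omega a) z) i j - ('D_(basis_cV R i) (Omega a) z) k j
  = ('D_(basis_cV R j) (Omega a) z) i k.
Proof.
move=> Mz; have S p q r := partials_commute p q M_open Mz (a_C2 r).
have combine (X Y W A B C D E F : R) : X = A - B -> Y = C - D -> W = E - F ->
    A = C -> B = F -> D = E -> X - Y = W.
  by move=> -> -> -> -> -> ->; ring.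
exact: combine (derive_Omega _ i j Mz) (derive_Omega _ k j Mz)
  (derive_Omega _ i k Mz) (S k i j) (S k j i) (S i j k).
Qed.

Context (l : nat) (h : 'cV[R]_m -> 'cV[R]_l -> R) (phi : 'cV[R]_l).
Hypotheses (h_C2 : Ck_on 2 M (h^~ phi)) (nondeg : forall z, M z -> \det (Omega a z) != 0).

Let unit_Omega z : M z -> Omega a z \in unitmx.
Proof. by move=> /nondeg; rewrite unitmxE unitfE. Qed.

Let hess_diff z i : M z -> differentiable ('D_(basis_cV R i) (h^~ phi)) z.
Proof.
move=> Mz; have [_ /(_ i)[_ Ci]] := h_C2.
by have [] := C1_differentiable (k := 0) M_open Mz Ci.
Qed.

Let differentiable_grad z : M z ->
  differentiable (fun z => (Drow (h^~ phi) z)^T) z.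
Proof.
move=> Mz; apply/differentiable_mxP => i j.
rewrite (_ : (fun _ => _) = 'D_(basis_cV R i) (h^~ phi)); first exact: hess_diff.
by apply/funext => y; rewrite !mxE.
Qed.

Lemma differentiable_Zh z : M z -> differentiable (Zh a h ^~ phi) z.
Proof.
move=> Mz; apply: differentiable_mulmx; last exact: differentiable_grad.
apply: differentiable_invmx; last exact: differentiable_Omega.
by apply: filterS (open_nbhs_nbhs (conj M_open Mz)) => y /unit_Omega.
Qed.

(** Differentiating [Omega Zh = grad h] expresses [Omega DZ] through the Hessian,
which is symmetric, and derivatives of [Omega], which closedness combines into
the derivative along [Zh]. *)
Lemma Hamiltonian_preserves_Omega z : M z ->
  'D_(Zh a h z phi) (Omega a) z =
  - ((Dmx (Zh a h ^~ phi) z)^T *m Omega a z + Omega a z *m Dmx (Zh a h ^~ phi) z).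
Proof.
move=> Mz; set Z := Zh a h z phi; set S := Dmx _ z; set Om := Omega a z.
have dZ := differentiable_Zh Mz; have dOm := differentiable_Omega Mz.
have E : \forall y \near z, Omega a y *m Zh a h y phi = (Drow (h^~ phi) y)^T.
  apply: (near_eq_on M_open Mz) => y My.
  by rewrite /Zh mulmxA mulmxV ?unit_Omega// mul1mx.
have ES i k : (Om *m S) i k = 'D_(basis_cV R k) ('D_(basis_cV R i) (h^~ phi)) z
    - \sum_j ('D_(basis_cV R k) (Omega a) z) i j * Z j 0.
  have D : 'D_(basis_cV R k) (Omega a) z *m Z + (Om *m S) *m basis_cV R k
      = 'D_(basis_cV R k) (fun z => (Drow (h^~ phi) z)^T) z.
    by rewrite -(near_eq_derive _ E) derive_mulmx// -mulmxA -(derive_Dmx _ dZ).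
  have entry (A B : 'M[R]_m) : (A *m Z + B *m basis_cV R k) i 0
      = \sum_j A i j * Z j 0 + B i k.
    by rewrite /basis_cV -colE !mxE.
  have := congr1 (fun A : 'cV[R]_m => A i 0) D.
  rewrite /= entry (derive_mxE _ _ _ (differentiable_grad Mz)).
  rewrite [X in _ = 'D__ X _](_ : _ = 'D_(basis_cV R i) (h^~ phi)); last first.
    by apply/funext => y; rewrite !mxE.
  by move=> <-; rewrite addrC addKr.
(* Both terms of the right-hand side are determined by [Om *m S]. *)
have EST : S^T *m Om = - (Om *m S)^T.
  by rewrite trmx_mul Omega_antisym mulmxN opprK.
apply/matrixP => i k; rewrite EST [RHS]mxE [X in - X]mxE mxE [_^T i k]mxE !ES.
rewrite (partials_commute k i M_open Mz h_C2).
rewrite (derive_sum_basis _ dOm) summxE.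
rewrite [RHS](_ : _ = \sum_j (('D_(basis_cV R k) (Omega a) z) i j * Z j 0
   - ('D_(basis_cV R i) (Omega a) z) k j * Z j 0)).
  by apply: eq_bigr => j _; rewrite mxE -mulrBl Omega_closed// mulrC.
by rewrite sumrB; ring.
Qed.

End Symplectic.

(** * Functions on the torus *)

Section TorusFunctions.
Context (R : realType) (m : nat).
Implicit Types (f : 'cV[R]_m -> R) (x w : 'cV[R]_m).

Lemma torus_fun_basis (X : Type) (f : 'cV[R]_m -> X) x i :
  torus_fun f -> f (x + basis_cV R i) = f x.
Proof.
move=> tf; rewrite -[RHS](tf x (delta_mx i 0)); congr (f (_ + _)).
by apply/matrixP => j k; rewrite !mxE; case: andP.
Qed.

(** A function constant along the flow is constant on each orbit, hence by
periodicity on its integer translates, which are dense. *)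
Lemma torus_fun_flow_const f w :
  (forall k : 'cV[int]_m, k != 0 -> \sum_i (k i 0)%:~R * w i 0 != 0) ->
  torus_fun f -> (forall x, {for x, continuous f}) ->
  (forall x, is_derive x w f 0) -> forall x, f x = f 0.
Proof.
move=> nonres tf cf df x; apply/eqP; rewrite -subr_eq0 -normr_eq0; apply/negPn/negP => ne.
have e0 : 0 < `|f x - f 0| by rewrite lt_neqAle eq_sym ne normr_ge0.
have : \forall y \near x, `|f x - f y| < `|f x - f 0|.
  exact: (cvgr_dist_lt f (f x) (cf x)).
move=> /nbhs_ballP[d /= d0 dU].
have [t [k]] := kronecker x d0 nonres.
have flow : f (t *: w) = f 0.
  have [s _] := @mvt_line _ _ f 0 w t (fun s _ => @ex_derive _ _ _ _ _ _ _ (df _)).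
  by rewrite !add0r (@derive_val _ _ _ _ _ _ _ (df _)) mulr0 => /eqP; rewrite subr_eq0 => /eqP.
move=> xk; have := dU (t *: w + map_mx intr k); rewrite -ball_normE/= => /(_ xk).
by rewrite tf flow ltxx.
Qed.

(** Uniform continuity of [g] on a compact rectangle, in the second variable
only; [t + tau] may leave the rectangle. *)
Lemma uniform_continuity_strip (g : R * R -> R) (e : R) :
  (forall p, {for p, continuous g}) -> 0 < e ->
  exists2 d, 0 < d & forall s t tau : R, `|s| <= 1 -> 0 <= t <= 1 -> `|tau| < d ->
    `|g (s, t + tau) - g (s, t)| < e.
Proof.
move=> cg e0.
have cK : compact (`[-1, 1]%classic `*` `[0, 1]%classic : set (R * R)).
  by apply: compact_setX; exact: segment_compact.
move/compact_near_coveringP : cK => /(_ R (nbhs (0 : R))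
  (fun tau p => `|g (p.1, p.2 + tau) - g p| < e)).
have nf : Filter (nbhs (0 : R)) by exact: nbhs_filter.
move=> /(_ nf) H.
have : \forall tau \near (0 : R), (`[-1, 1]%classic `*` `[0, 1]%classic : set (R * R))
    `<=` [set p | `|g (p.1, p.2 + tau) - g p| < e].
  apply: H => p _.
  have e2 : 0 < e / 2 by rewrite divr_gt0.
  have gp : \forall q \near p, `|g p - g q| < e / 2.
    exact: (cvgr_dist_lt g (g p) (cg p)).
  move: gp => /nbhs_ballP[r /= r0 gr].
  have r2 : 0 < r / 2 by rewrite divr_gt0.
  exists (ball p (r / 2), ball (0 : R) (r / 2)).
    by split; exact: nbhsx_ballx.
  move=> [q tau] [/= [q1 q2] tau_r].
  have lt_r (x y : R) : ball x (r / 2) y -> `|x - y| < r / 2 by rewrite -ball_normE.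
  have ball_r (x y : R) : `|x - y| < r -> ball x r y by rewrite -ball_normE.
  have h0 := gr q; have h1 := gr (q.1, q.2 + tau).
  have {}h0 : `|g p - g q| < e / 2.
    by apply: h0; split; apply: ball_r; (apply: lt_le_trans (lt_r _ _ _) _; [|lra]).
  have {}h1 : `|g p - g (q.1, q.2 + tau)| < e / 2.
    apply: h1; split; apply: ball_r => /=.
      by apply: lt_le_trans (lt_r _ _ q1) _; lra.
    rewrite opprD addrA (le_lt_trans (ler_normB _ _))// [ltRHS](splitr r) ltrD//.
    by have := lt_r _ _ tau_r; rewrite sub0r normrN.
  rewrite (le_lt_trans (ler_distD (g p) _ _))// [ltRHS](splitr e) ltrD//.
  by rewrite distrC.
move=> /nbhs_ballP[d /= d0 dU]; exists d => // s t tau s1 t1 td.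
have td' : ball (0 : R) d tau by rewrite -ball_normE/= sub0r normrN.
apply: (dU tau td' (s, t)).
by split; rewrite /= in_itv/= ?t1// -ler_norml.
Qed.

Lemma differentiable_shifted f x y :
  (forall x, differentiable f x) -> differentiable (fun z => f (z + y)) x.
Proof.
by move=> df; apply: (@differentiable_comp _ _ _ _ (fun z => z + y)).
Qed.

Lemma derive_shifted f x y v : 'D_v (fun z => f (z + y)) x = 'D_v f (x + y).
Proof.
have E : (fun h : R => h^-1 *: (f (h *: v + x + y) - f (x + y)))
  = (fun h : R => h^-1 *: (f (h *: v + (x + y)) - f (x + y))).
  by apply/funext => h; rewrite addrA.
by rewrite /derive E.
Qed.

(** The integral of a curl over a coordinate square of the torus is zero.  To
avoid integrals, sum over a grid of step [1 / N] in direction [j]: by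
periodicity in direction [i] the sum of the [d_i bj] vanishes on some line
(Rolle), and by periodicity in direction [j] so does the sum of the [d_j bi] at
suitable points of the grid intervals of this line (mean value theorem).  As
[d_j bi] is uniformly continuous, the constant is arbitrarily small. *)
Lemma torus_curl_const_eq0 (bi bj : 'cV[R]_m -> R) (i j : 'I_m) (c : R) :
  torus_fun bi -> torus_fun bj ->
  (forall x, differentiable bi x) -> (forall x, differentiable bj x) ->
  (forall x, {for x, continuous ('D_(basis_cV R j) bi)}) ->
  (forall x, 'D_(basis_cV R i) bj x - 'D_(basis_cV R j) bi x = c) -> c = 0.
Proof.
move=> ti tj di dj cD curl.
apply/eqP; rewrite -normr_eq0; apply/negPn/negP => ne.
have e0 : 0 < `|c| by rewrite lt_neqAle eq_sym ne normr_ge0.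
set ei := basis_cV R i in curl; set ej := basis_cV R j in cD curl.
pose v (p : R * R) := 'D_ej bi (p.1 *: ei + p.2 *: ej).
have cv p : {for p, continuous v}.
  have c1 : (fun q : R * R => q.1) @ nbhs p --> p.1 by case: (p) => ? ?; exact: cvg_fst.
  have c2 : (fun q : R * R => q.2) @ nbhs p --> p.2 by case: (p) => ? ?; exact: cvg_snd.
  have lc : {for p, continuous (fun q : R * R => q.1 *: ei + q.2 *: ej)}.
    apply: (@cvgD _ _ _ (nbhs p)); apply: (@cvgZ _ _ _ (nbhs p)) => //; exact: cvg_cst.
  exact: (continuous_comp lc (cD _)).
have [d d0 dv] := uniform_continuity_strip cv e0.
pose N := (Num.truncn d^-1).+1.
have N0 : 0 < N%:R :> R by rewrite ltr0n.
have Nd : N%:R^-1 < d by rewrite invf_plt ?posrE// truncnS_gt.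
(* [S] is periodic in direction [i]; [S0] below is Rolle's theorem for it. *)
pose S x := \sum_(k < N) bj (x + (k%:R / N%:R) *: ej).
have dS x : is_derive x ei S (\sum_(k < N) 'D_ei bj (x + (k%:R / N%:R) *: ej)).
  rewrite /S; apply: DeriveDef.
    by apply/diff_derivable/differentiable_big_sum => k; exact: differentiable_shifted.
  rewrite [LHS]derive_big_sum => [|k]; last exact: differentiable_shifted.
  by apply: eq_bigr => k _; exact: derive_shifted.
have [s s1 ES] : exists2 s : R, `|s| <= `|1 : R| &
    S (0 + 1 *: ei) - S 0 = 1 * 'D_ei S (0 + s *: ei).
  by apply: mvt_line => s _; have [] := dS (0 + s *: ei).
have S0 : \sum_(k < N) 'D_ei bj (s *: ei + (k%:R / N%:R) *: ej) = 0.
  move: ES; rewrite mul1r !add0r (@derive_val _ _ _ _ _ _ _ (dS _)) => <-.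
  rewrite scale1r /S -sumrB big1// => k _.
  by rewrite addrC [ei + _]addrC torus_fun_basis// add0r addNr.
rewrite normr1 in s1.
have step (k : 'I_N) : exists2 tau : R, `|tau| <= N%:R^-1 &
    bi (s *: ei + (k.+1%:R / N%:R) *: ej) - bi (s *: ei + (k%:R / N%:R) *: ej)
    = N%:R^-1 * v (s, k%:R / N%:R + tau).
  have [tau tN E] := @mvt_line _ _ bi (s *: ei + (k%:R / N%:R) *: ej) ej N%:R^-1
     (fun s _ => diff_derivable (di _)).
  exists tau; first by rewrite (le_trans tN)// ger0_norm// invr_ge0 ltW.
  rewrite /v /= scalerDl addrA -E -!addrA -scalerDl -natr1 mulrDl mul1r.
  by [].
have /choice[tau Htau] : forall k : 'I_N, exists tau : R, `|tau| <= N%:R^-1 /\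
    bi (s *: ei + (k.+1%:R / N%:R) *: ej) - bi (s *: ei + (k%:R / N%:R) *: ej)
    = N%:R^-1 * v (s, k%:R / N%:R + tau).
  by move=> k; have [t ? ?] := step k; exists t.
have V0 : \sum_(k < N) v (s, k%:R / N%:R + tau k) = 0.
  have : N%:R^-1 * \sum_(k < N) v (s, k%:R / N%:R + tau k) = 0.
    rewrite mulr_sumr -(eq_bigr _ (fun k _ => (Htau k).2)).
    rewrite -(big_mkord xpredT (fun k => bi (s *: ei + (k.+1%:R / N%:R) *: ej)
       - bi (s *: ei + (k%:R / N%:R) *: ej))).
    rewrite (@telescope_sumr _ 0 N (fun k => bi (s *: ei + (k%:R / N%:R) *: ej)))//.
    by rewrite mul0r scale0r addr0 divff ?gt_eqF// scale1r torus_fun_basis// subrr.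
  by move=> /eqP; rewrite mulf_eq0 invr_eq0 gt_eqF//= => /eqP.
have : N%:R * `|c| = `|\sum_(k < N) (v (s, k%:R / N%:R + tau k) - v (s, k%:R / N%:R))|.
  rewrite sumrB V0 sub0r normrN -[in RHS](subr0 (\sum_(k < N) _)) -{2}S0 distrC -sumrB.
  rewrite (eq_bigr (fun=> c)) => [|k _]; last exact: curl.
  by rewrite sumr_const card_ord normrMn mulr_natl.
apply/eqP; rewrite gt_eqF//.
apply: (le_lt_trans (ler_norm_sum _ _ _)).
rewrite [ltRHS](_ : _ = \sum_(k < N) `|c|); last by rewrite sumr_const card_ord mulr_natl.
apply: ltr_sum => [|k _]; first by apply/hasP; exists ord0; rewrite ?mem_index_enum.
apply: dv => //; last exact: le_lt_trans (Htau k).1 Nd.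
by rewrite divr_ge0//= ler_pdivrMr// mul1r ler_nat ltnW.
Qed.

End TorusFunctions.

(** * The linear algebra of the torsion *)

(** Primed letters stand for derivatives along the flow; [T] is [T_h] and [C]
is [B^-1 B']. *)
Section TorsionAlgebra.
Context (R : realType) (m n : nat).
Variables (Om Om' S T : 'M[R]_m) (L L' Nt Nt' : 'M[R]_(m, n)) (A A' C : 'M[R]_n).
Hypotheses (Om_antisym : Om^T = - Om)
  (Om_flow : Om' = - (S^T *m Om + Om *m S))
  (L_flow : L' = S *m L)
  (L_isotropic : L^T *m Om *m L = 0)
  (L_Nt : L^T *m Om *m Nt = - 1%:M)
  (L_Nt_flow : L'^T *m Om *m Nt + L^T *m Om' *m Nt + L^T *m Om *m Nt' = 0)
  (Nt_flow : Om *m Nt' = Om *m S *m Nt - T *m Nt + Om *m Nt *m C)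
  (A_def : A = - (2^-1 *: (Nt^T *m Om *m Nt)))
  (A_flow : A' = - (2^-1 *: (Nt'^T *m Om *m Nt + Nt^T *m Om' *m Nt
                             + Nt^T *m Om *m Nt'))).

Let Nt_L : Nt^T *m Om *m L = 1%:M.
Proof.
apply: trmx_inj; rewrite !trmx_mul trmxK Om_antisym mulNmx mulmxN mulmxA L_Nt.
by rewrite opprK trmx1.
Qed.

Let W_A : Nt^T *m Om *m Nt = - (A *+ 2).
Proof.
by rewrite A_def mulNrn opprK -scaler_nat scalerA mulfV ?scale1r ?pnatr_eq0.
Qed.

Let A_antisym : A^T = - A.
Proof.
rewrite A_def linearN linearZ/= !trmx_mul trmxK Om_antisym.
by rewrite mulNmx mulmxN mulmxA scalerN.
Qed.

(** In [L_Nt_flow] the terms with [S] cancel. *)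
Lemma L_torsion_Nt : L^T *m T *m Nt = - C.
Proof.
have := L_Nt_flow; rewrite L_flow Om_flow trmx_mul mulmxN mulNmx mulmxDr mulmxDl.
rewrite -[L^T *m Om *m Nt']mulmxA Nt_flow !mulmxDr mulmxN !mulmxA L_Nt mulNmx mul1mx.
move: (L^T *m S^T *m Om *m Nt) (L^T *m Om *m S *m Nt) (L^T *m T *m Nt) => X Y Z E.
apply/matrixP => i j; move/matrixP: E => /(_ i j).
by rewrite !mxE; lra.
Qed.

(** The terms with [S] cancel against the derivative of [Om]. *)
Lemma A_flow_torsion : A' =
  - (2^-1 *: ((Nt^T *m T *m Nt)^T - Nt^T *m T *m Nt)) + A *m C + C^T *m A.
Proof.
have NtE : Nt^T *m Om *m Nt' = Nt^T *m Om *m S *m Nt - Nt^T *m T *m Nt - (A *m C) *+ 2.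
  rewrite -mulmxA Nt_flow !mulmxDr mulmxN !mulmxA W_A.
  by rewrite mulNmx -scaler_nat -scalemxAl scaler_nat.
have NtET : Nt'^T *m Om *m Nt = - (Nt^T *m Om *m Nt')^T.
  by rewrite !trmx_mul trmxK Om_antisym mulNmx mulmxN opprK mulmxA.
have SE : Nt^T *m S^T *m Om *m Nt = - (Nt^T *m Om *m S *m Nt)^T.
  by rewrite !trmx_mul trmxK Om_antisym mulNmx !mulmxN opprK !mulmxA.
rewrite A_flow NtET NtE Om_flow mulmxN mulNmx mulmxDr mulmxDl !mulmxA SE.
have -> : C^T *m A = - (A *m C)^T by rewrite trmx_mul A_antisym mulmxN opprK.
move: (Nt^T *m Om *m S *m Nt) (Nt^T *m T *m Nt) (A *m C) => X Y Z.
by apply/matrixP => i j; rewrite !mxE; field.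
Qed.

Let N := L *m A + Nt.

Lemma torsion_algebra :
  N^T *m Om *m (S *m N - (L' *m A + L *m A' + Nt')) =
  - (2^-1 *: (Nt^T *m (T + T^T) *m Nt)) + Nt^T *m T^T *m N + N^T *m T *m Nt.
Proof.
have -> : S *m N - (L' *m A + L *m A' + Nt') = S *m Nt - Nt' - L *m A'.
  rewrite /N L_flow mulmxDr mulmxA; move: (_ *m A) (_ *m A') (_ *m Nt) => X Y Z.
  by apply/matrixP => i j; rewrite !mxE; ring.
have N_L : N^T *m Om *m L = 1%:M.
  rewrite /N linearD/= trmx_mul !mulmxDl Nt_L.
  by rewrite -[_ *m Om *m L]mulmxA -mulmxA [L^T *m _]mulmxA L_isotropic mulmx0 add0r.
have N_Nt : N^T *m Om *m Nt = - A.
  rewrite /N linearD/= trmx_mul !mulmxDl W_A.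
  rewrite -[_ *m Om *m Nt]mulmxA -mulmxA [L^T *m _]mulmxA L_Nt mulmxN mulmx1.
  by rewrite A_antisym opprK mulr2n opprD addrA subrr sub0r.
have TL : Nt^T *m T^T *m L = - C^T.
  by apply: trmx_inj; rewrite linearN/= !trmx_mul !trmxK mulmxA L_torsion_Nt.
have OmE : Om *m (S *m Nt - Nt') = T *m Nt - Om *m Nt *m C.
  rewrite mulmxBr Nt_flow mulmxA.
  move: (_ *m S *m Nt) (T *m Nt) (_ *m C) => X Y Z.
  by apply/matrixP => i j; rewrite !mxE; ring.
rewrite mulmxBr [N^T *m Om *m (L *m A')]mulmxA N_L mul1mx.
rewrite -[N^T *m Om *m (S *m Nt - Nt')]mulmxA OmE mulmxBr !mulmxA N_Nt mulNmx opprK.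
rewrite A_flow_torsion {2}/N mulmxDr mulmxA TL mulNmx.
rewrite mulmxDr mulmxDl.
have -> : Nt^T *m T^T *m Nt = (Nt^T *m T *m Nt)^T by rewrite !trmx_mul trmxK mulmxA.
move: (N^T *m T *m Nt) (Nt^T *m T *m Nt) (A *m C) (C^T *m A) => X Y Z W.
by apply/matrixP => i j; rewrite !mxE; field.
Qed.

End TorsionAlgebra.

(** * Invariant tori *)

Section Flow.
Context (R : realType) (n l : nat) (omega : 'cV[R]_n) (alpha : 'cV[R]_l).

Lemma LopE p q (F : 'cV[R]_n -> 'cV[R]_l -> 'M[R]_(p, q)) theta phi :
  differentiable (uncurry_cV F) (col_mx theta phi) ->
  Lop omega alpha F theta phi =
  - 'D_(col_mx omega alpha) (uncurry_cV F) (col_mx theta phi).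
Proof.
move=> dF; apply: etrans (congr1 -%R (esym (derive_sum_basis _ dF))).
congr (- _); apply: etrans (esym (big_split_ord _ _ _)).
apply: (congr2 +%R).
  apply: eq_bigr => i _; rewrite col_mxEu; congr (_ *: _).
  by rewrite derive_uncurry_l -basis_lshift.
apply: eq_bigr => i _; rewrite col_mxEd; congr (_ *: _).
by rewrite derive_uncurry_r /basis_cV -delta_mx_dshift.
Qed.

Lemma nonresonant_col_mx : nonresonant omega alpha ->
  forall k : 'cV[int]_(n + l), k != 0 ->
  \sum_i (k i 0)%:~R * (col_mx omega alpha) i 0 != 0.
Proof.
move=> nonres k k0; have kE := vsubmxK k.
have -> : \sum_i (k i 0)%:~R * (col_mx omega alpha) i 0 =
    \sum_i (usubmx k i 0)%:~R * omega i 0 + \sum_j (dsubmx k j 0)%:~R * alpha j 0.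
  rewrite big_split_ord/=; apply: (congr2 +%R); apply: eq_bigr => i _.
    by rewrite col_mxEu mxE.
  by rewrite col_mxEd mxE.
apply: nonres; apply: contra k0 => /eqP[k1 k2].
by rewrite -kE k1 k2 col_mx0.
Qed.

End Flow.

(** If [v] is in the kernel of the Gram matrix then [L v] has length zero, and [L] is
injective. *)
Lemma gram_unitmx (R : realType) m n (G : 'M[R]_m) (L : 'M[R]_(m, n)) :
  (forall v : 'cV[R]_m, v != 0 -> 0 < (v^T *m G *m v) 0 0) -> \rank L = n ->
  L^T *m G *m L \in unitmx.
Proof.
move=> Gpos rL; rewrite -row_free_unit; apply/inj_row_free => v v0.
have Lv0 : L *m v^T = 0.
  apply/eqP/negPn/negP => /Gpos; rewrite trmx_mul trmxK.
  have -> : v *m L^T *m G *m (L *m v^T) = v *m (L^T *m G *m L) *m v^T by rewrite !mulmxA.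
  by rewrite v0 mul0mx mxE ltxx.
have rf : row_free L^T by rewrite /row_free mxrank_tr rL.
apply: (row_free_inj rf); rewrite mul0mx; apply: trmx_inj.
by rewrite trmx_mul trmxK Lv0 trmx0.
Qed.

Lemma mulmx_basis (R : realType) m n (A : 'M[R]_(m, n)) i j :
  (A *m basis_cV R j) i 0 = A i j.
Proof. by rewrite /basis_cV -colE mxE. Qed.

(** The derivative of [L^T Om L] along the flow, once the flow equations for
[L] and [Om] are inserted. *)
Lemma pullback_cancel (R : realType) m n (L : 'M[R]_(m, n)) (S Om : 'M[R]_m) :
  ((S *m L)^T *m Om + L^T *m - (S^T *m Om + Om *m S)) *m L
  + L^T *m Om *m (S *m L) = 0.
Proof.
rewrite trmx_mul mulmxN mulmxDr opprD !mulmxDl !mulNmx !mulmxA.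
by rewrite addrA subrr sub0r addNr.
Qed.

Section InvariantTorus.
Context (R : realType) (n l : nat).
Context (M : set 'cV[R]_(2 * n)) (a : 'cV[R]_(2 * n) -> 'cV[R]_(2 * n))
  (G : 'cV[R]_(2 * n) -> 'M[R]_(2 * n)) (h : 'cV[R]_(2 * n) -> 'cV[R]_l -> R)
  (K : 'cV[R]_n -> 'cV[R]_l -> 'cV[R]_(2 * n)) (omega : 'cV[R]_n) (alpha : 'cV[R]_l).
Hypotheses (M_open : open M) (a_C2 : forall i, Ck_on 2 M (fun z => a z i 0))
  (nondeg : forall z, M z -> \det (Omega a z) != 0)
  (h_C2 : forall phi, Ck_on 2 M (h^~ phi))
  (K_in_M : forall theta phi, M (K theta phi))
  (K_C2 : forall i, Ck_on 2 setT (fun x => uncurry_cV K x i 0))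
  (K_invariant : forall theta phi,
    Zh a h (K theta phi) phi = - Lop omega alpha K theta phi).
Hypotheses (nonres : nonresonant omega alpha)
  (K_torus_theta : forall phi, torus_fun (K^~ phi))
  (K_torus_phi : forall theta, torus_fun (K theta))
  (G_C1 : forall i j, Ck_on 1 M (fun z => G z i j))
  (G_pos : forall z (v : 'cV[R]_(2 * n)), M z -> v != 0 -> 0 < (v^T *m G z *m v) 0 0)
  (L_rank : forall theta phi, \rank (Lframe K theta phi) = n).
Implicit Types (x : 'cV[R]_(n + l)).

(** The torus is parameterized by the stacked angles [x = (theta, phi)]. *)
Let w : 'cV[R]_(n + l) := col_mx omega alpha.
Let ex (j : 'I_n) : 'cV[R]_(n + l) := basis_cV R (lshift l j).
Let P : 'cV[R]_(n + l) -> 'cV[R]_(2 * n) := uncurry_cV K.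
Let L : 'cV[R]_(n + l) -> 'M[R]_(2 * n, n) := uncurry_cV (Lframe K).
Let Om x := Omega a (P x).
Let S x := Dmx (Zh a h ^~ (dsubmx x)) (P x).

Let P_in_M x : M (P x).
Proof. exact: K_in_M. Qed.

Let dP x : differentiable P x.
Proof.
apply/differentiable_mxP => i j; rewrite ord1.
by have [] := C1_differentiable (k := 1) openT (I : setT x) (K_C2 i).
Qed.

Let LE x i j : L x i j = 'D_(ex j) (fun x => P x i 0) x.
Proof.
rewrite /L /uncurry_cV /Lframe mxE derive_uncurry_l -basis_lshift vsubmxK.
by rewrite derive_mxE.
Qed.

Lemma derive_torus_theta x j : 'D_(ex j) P x = L x *m basis_cV R j.
Proof.
apply/matrixP => i k; rewrite ord1 (derive_mxE _ _ _ (dP x)) -LE.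
by rewrite mulmx_basis.
Qed.

Let LiE i j : (fun x => L x i j) = 'D_(ex j) (fun x => P x i 0).
Proof. by apply/funext => x; rewrite LE. Qed.

Let L_C1 i j : Ck_on 1 setT (fun x => L x i j).
Proof. by rewrite LiE; have [_ /(_ (lshift l j))[]] := K_C2 i. Qed.

Lemma differentiable_Lframe x : differentiable L x.
Proof.
apply/differentiable_mxP => i j.
by have [] := C1_differentiable (k := 0) openT (I : setT x) (L_C1 i j).
Qed.

Lemma derive_torus_flow x : 'D_w P x = Zh a h (P x) (dsubmx x).
Proof.
have dPx : differentiable (uncurry_cV K) (col_mx (usubmx x) (dsubmx x)).
  by rewrite vsubmxK; exact: dP.
have := K_invariant (usubmx x) (dsubmx x); rewrite (LopE _ _ dPx) opprK vsubmxK => E.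
exact: esym E.
Qed.

(** The linearized flow: commute the derivative along the flow with the
derivative in [theta], and differentiate the invariance equation. *)
Lemma derive_Lframe_flow x : 'D_w L x = S x *m L x.
Proof.
apply/matrixP => i j; rewrite (derive_mxE _ _ _ (differentiable_Lframe x)) LiE.
rewrite (directional_partial_commute _ _ openT (I : setT x) (K_C2 i)).
have dZ := differentiable_Zh M_open a_C2 (h_C2 (dsubmx x)) nondeg (P_in_M x).
have E : 'D_w (fun y => P y i 0) = (fun y => Zh a h (P y) (dsubmx y) i 0).
  by apply/funext => y; rewrite -derive_mxE ?derive_torus_flow//; exact: dP.
rewrite E.
have -> : 'D_(ex j) (fun y => Zh a h (P y) (dsubmx y) i 0) x =
    'D_(ex j) (fun y => (Zh a h ^~ (dsubmx x) \o P) y i 0) x.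
    (* A derivative in [theta] does not see the argument [phi] of [Zh]. *)
  have dsub_ex (t : R) : dsubmx (t *: ex j + x) = dsubmx x.
    by rewrite /ex basis_lshift linearD linearZ/= col_mxKd scaler0 add0r.
  have Eq : (fun t : R => t^-1 *: (Zh a h (P (t *: ex j + x)) (dsubmx (t *: ex j + x)) i 0
       - Zh a h (P x) (dsubmx x) i 0))
    = (fun t : R => t^-1 *: (Zh a h (P (t *: ex j + x)) (dsubmx x) i 0
       - Zh a h (P x) (dsubmx x) i 0)).
    by apply/funext => t; rewrite dsub_ex.
  by rewrite /derive Eq.
rewrite -(derive_mxE _ _ _ (differentiable_comp (dP x) dZ)).
rewrite (derive_comp _ (dP x) dZ) (derive_Dmx _ dZ) derive_torus_theta mulmxA.
by rewrite mulmx_basis.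
Qed.

Let dOm x : differentiable Om x.
Proof.
apply: (@differentiable_comp _ _ _ _ P (Omega a)); first exact: dP.
exact: (differentiable_Omega M_open a_C2).
Qed.

Lemma derive_Omega_flow x :
  'D_w Om x = - ((S x)^T *m Om x + Om x *m S x).
Proof.
have dO := differentiable_Omega M_open a_C2 (P_in_M x).
rewrite [LHS](derive_comp _ (dP x) dO) derive_torus_flow.
exact: (Hamiltonian_preserves_Omega M_open a_C2 (h_C2 _) nondeg).
Qed.

Let pullback x := (L x)^T *m Om x *m L x.

Let dpullback x : differentiable pullback x.
Proof.
have dL := differentiable_Lframe x.
by apply: differentiable_mulmx => //; apply: differentiable_mulmx => //;
  exact: differentiable_trmx.
Qed.

Lemma derive_pullback_flow x : 'D_w pullback x = 0.
Proof.
have dL := differentiable_Lframe x; have dLT := differentiable_trmx dL.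
rewrite (derive_mulmx _ (differentiable_mulmx dLT (dOm x)) dL).
rewrite (derive_mulmx _ dLT (dOm x)) (derive_trmx _ dL) derive_Lframe_flow.
by rewrite derive_Omega_flow pullback_cancel.
Qed.

Let P_torus : torus_fun P.
Proof.
move=> x k; rewrite /P /uncurry_cV !linearD/= -map_usubmx -map_dsubmx.
by rewrite (K_torus_theta _ _ _) K_torus_phi.
Qed.

Let L_torus : torus_fun L.
Proof.
move=> x k; apply/matrixP => i j; rewrite !LE -derive_shifted.
have E : (fun z => P (z + map_mx intr k) i 0) = (fun z => P z i 0).
  by apply/funext => z; rewrite P_torus.
by rewrite E.
Qed.

(** Where nonresonance is used: the entry is invariant under a dense flow. *)
Lemma pullback_const i j x y : pullback x i j = pullback y i j.
Proof.
have [f fE] : exists f, f = fun z => pullback z i j by exists (fun z => pullback z i j).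
have ext z : f z = pullback z i j by rewrite fE.
suff c z : f z = f 0 by exact: etrans (esym (ext x)) (etrans (c x) (etrans (esym (c y)) (ext y))).
apply: (@torus_fun_flow_const R _ f w).
- exact: nonresonant_col_mx.
- by move=> u k; rewrite !ext /pullback /Om P_torus L_torus.
- move=> u; apply: differentiable_continuous; rewrite fE.
  by have /differentiable_mxP dp := dpullback u; exact: dp.
move=> u; rewrite fE; apply: DeriveDef.
  by apply: diff_derivable; have /differentiable_mxP dp := dpullback u; exact: dp.
apply: etrans (esym (derive_mxE w i j (dpullback u))) _.
by rewrite derive_pullback_flow mxE.
Qed.

(** The coefficients of the pulled back potential, restricted to the [theta]
directions. *)
Let beta (j : 'I_n) x : R := \sum_k a (P x) k 0 * L x k j.

Let da z : M z -> differentiable a z.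
Proof. exact: (C1_potential_differentiable M_open a_C2). Qed.

Let daP k x : differentiable (fun x => a (P x) k 0) x.
Proof.
have /differentiable_mxP/(_ k 0) := da (P_in_M x).
exact: (@differentiable_comp _ _ _ _ P (fun z => a z k 0)).
Qed.

Let dLij i j x : differentiable (fun x => L x i j) x.
Proof. by have /differentiable_mxP := differentiable_Lframe x. Qed.

Let dbeta j x : differentiable (beta j) x.
Proof.
by apply: differentiable_big_sum => k; exact: differentiable_mul.
Qed.

Let derive_beta i j x : 'D_(ex i) (beta j) x =
  \sum_k ((Dmx a (P x) *m L x) k i * L x k j
          + a (P x) k 0 * 'D_(ex i) (fun x => L x k j) x).
Proof.
rewrite [LHS]derive_big_sum => [|k]; last exact: differentiable_mul.
apply: eq_bigr => k _.
apply: (etrans (derive_mul _ (daP k x) (dLij k j x))).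
apply: (congr2 +%R) => //; congr (_ * _).
have dPM := da (P_in_M x).
have /(congr1 (fun A : 'cV[R]_(2 * n) => A k 0)) := derive_comp (ex i) (dP x) dPM.
rewrite (derive_Dmx _ dPM) derive_torus_theta mulmxA mulmx_basis => <-.
by rewrite (derive_mxE _ _ _ (differentiable_comp (dP x) dPM)).
Qed.

(** Exactness: the terms with second derivatives of [K] cancel. *)
Let curl_beta i j x :
  'D_(ex i) (beta j) x - 'D_(ex j) (beta i) x = pullback x i j.
Proof.
rewrite !derive_beta !big_split/=.
have swap : \sum_k a (P x) k 0 * 'D_(ex i) (fun x => L x k j) x =
         \sum_k a (P x) k 0 * 'D_(ex j) (fun x => L x k i) x.
  apply: eq_bigr => k _; congr (_ * _); rewrite !LiE.
  exact: (partials_commute _ _ openT (I : setT x) (K_C2 k)).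
rewrite swap opprD addrACA subrr addr0.
have -> : pullback x i j = ((L x)^T *m (Dmx a (P x))^T *m L x) i j
    - ((L x)^T *m Dmx a (P x) *m L x) i j.
  have entry (A B : 'M[R]_n) : A i j - B i j = (A - B) i j by rewrite !mxE.
  by rewrite entry /pullback /Om /Omega -mulmxBl -mulmxBr.
have prod (A B : 'M[R]_(2 * n, n)) p q : \sum_k A k p * B k q = (A^T *m B) p q.
  by rewrite mxE; apply: eq_bigr => k _; rewrite mxE.
rewrite !prod -trmx_mul; congr (_ - _).
have -> : (Dmx a (P x) *m L x)^T *m L x = ((L x)^T *m Dmx a (P x) *m L x)^T.
  by rewrite !trmx_mul trmxK mulmxA.
by rewrite [LHS]mxE.
Qed.

Let continuous_derive_beta i j x : {for x, continuous ('D_(ex i) (beta j))}.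
Proof.
have E : 'D_(ex i) (beta j) = fun x =>
    \sum_k ((\sum_p 'D_(basis_cV R p) (fun z => a z k 0) (P x) * L x p i) * L x k j
            + a (P x) k 0 * 'D_(ex i) (fun x => L x k j) x).
  apply/funext => y; rewrite derive_beta; apply: eq_bigr => k _.
  apply: (congr2 +%R) => //; congr (_ * _); rewrite mxE; apply: eq_bigr => p _.
  by rewrite mxE derive_mxE//; exact/da/P_in_M.
have cL k q : {for x, continuous (fun x => L x k q)}.
  exact: differentiable_continuous.
have cDa k p : {for x, continuous (fun x => 'D_(basis_cV R p) (fun z => a z k 0) (P x))}.
  have ck : {for P x, continuous ('D_(basis_cV R p) (fun z => a z k 0))}.
    by apply: (@C1_partial_continuous _ _ 1 M); [exact: P_in_M|exact: a_C2].
  exact: (continuous_comp (differentiable_continuous (dP x)) ck).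
have cDL k : {for x, continuous ('D_(ex i) (fun x => L x k j))}.
  by apply: (@C1_partial_continuous _ _ 0 setT); [|exact: L_C1].
have ca k : {for x, continuous (fun x => a (P x) k 0)}.
  exact: differentiable_continuous.
rewrite E; apply: (@cvg_sum _ _ _ _ (nbhs x)) => k.
apply: (@cvgD _ _ _ (nbhs x)); last by apply: (@cvgM _ _ (nbhs x)); [exact: ca|exact: cDL].
apply: (@cvgM _ _ (nbhs x)); last exact: cL.
apply: (@cvg_sum _ _ _ _ (nbhs x)) => p.
by apply: (@cvgM _ _ (nbhs x)); [exact: cDa|exact: cL].
Qed.

(** Where exactness of the symplectic form is used: a constant curl of periodic
functions is zero. *)
Lemma invariant_torus_isotropic x : pullback x = 0.
Proof.
have t j : torus_fun (beta j).
  by move=> y k; rewrite /beta P_torus L_torus.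
apply/matrixP => i j; rewrite [RHS]mxE.
have curl y := etrans (curl_beta i j y) (pullback_const i j y x).
exact: (@torus_curl_const_eq0 R _ (beta i) (beta j) (lshift l i) (lshift l j) _
  (t i) (t j) (dbeta i) (dbeta j) (@continuous_derive_beta j i) curl).
Qed.

Let B : 'cV[R]_(n + l) -> 'M[R]_n := uncurry_cV (Bframe G K).
Let Nt : 'cV[R]_(n + l) -> 'M[R]_(2 * n, n) := uncurry_cV (Ntilde a G K).
Let A : 'cV[R]_(n + l) -> 'M[R]_n := uncurry_cV (Aframe a G K).
Let N : 'cV[R]_(n + l) -> 'M[R]_(2 * n, n) := uncurry_cV (Nframe a G K).

Let unit_Om z : M z -> Omega a z \in unitmx.
Proof. by move=> /nondeg; rewrite unitmxE unitfE. Qed.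

Let unit_G z : M z -> G z \in unitmx.
Proof.
move=> Mz; have := gram_unitmx (fun v => @G_pos z v Mz) (mxrank1 _ _).
by rewrite trmx1 mul1mx mulmx1.
Qed.

Let unit_J z : M z -> Jmx a G z \in unitmx.
Proof.
move=> Mz; rewrite /Jmx -scaleN1r unitmxZ ?unitrN1//.
by rewrite unitmx_mul unitmx_inv unit_Om// unit_G.
Qed.

Let unit_gram x : (L x)^T *m G (P x) *m L x \in unitmx.
Proof. by apply: gram_unitmx (L_rank _ _) => v; exact/G_pos/P_in_M. Qed.

Let unit_B x : B x \in unitmx.
Proof. by rewrite unitmx_inv; exact: unit_gram. Qed.

Let dG z : M z -> differentiable G z.
Proof.
move=> Mz; apply/differentiable_mxP => i j.
by have [] := C1_differentiable (k := 0) M_open Mz (G_C1 i j).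
Qed.

Let dJ z : M z -> differentiable (Jmx a G) z.
Proof.
move=> Mz.
have dOmV : differentiable (fun z => invmx (Omega a z)) z.
  apply: differentiable_invmx; last exact: (differentiable_Omega M_open a_C2).
  by apply: filterS (open_nbhs_nbhs (conj M_open Mz)) => y /unit_Om.
exact: differentiableN (differentiable_mulmx dOmV (dG Mz)).
Qed.

Let dJP x : differentiable (fun x => Jmx a G (P x)) x.
Proof. exact: (differentiable_comp (dP x) (dJ (P_in_M x))). Qed.

Let dB x : differentiable B x.
Proof.
have dL := differentiable_Lframe x.
have dGP : differentiable (fun x => G (P x)) x.
  exact: (differentiable_comp (dP x) (dG (P_in_M x))).
apply: (@differentiable_invmx _ _ _ (fun x => (L x)^T *m G (P x) *m L x)).
  exact: (@filterE _ (nbhs x) _ _ unit_gram).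
exact: differentiable_mulmx (differentiable_mulmx (differentiable_trmx dL) dGP) dL.
Qed.

Let dJL x : differentiable (fun x => Jmx a G (P x) *m L x) x.
Proof. exact: differentiable_mulmx (dJP x) (differentiable_Lframe x). Qed.

Let dNt x : differentiable Nt x.
Proof. exact: differentiable_mulmx (dJL x) (dB x). Qed.

Let dNtTOm x : differentiable (fun x => (Nt x)^T *m Om x) x.
Proof. exact: differentiable_mulmx (differentiable_trmx (dNt x)) (dOm x). Qed.

Let W x := (Nt x)^T *m Om x *m Nt x.

Let dW x : differentiable W x.
Proof. exact: differentiable_mulmx (dNtTOm x) (dNt x). Qed.

Let dA x : differentiable A x.
Proof. exact: (differentiableN (differentiableZ 2^-1 (dW x))). Qed.

Let dLA x : differentiable (fun x => L x *m A x) x.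
Proof. exact: differentiable_mulmx (differentiable_Lframe x) (dA x). Qed.

Let dN x : differentiable N x.
Proof. exact: differentiableD (dLA x) (dNt x). Qed.

Let derive_A x : 'D_w A x = - (2^-1 *: (('D_w Nt x)^T *m Om x *m Nt x
  + (Nt x)^T *m 'D_w Om x *m Nt x + (Nt x)^T *m Om x *m 'D_w Nt x)).
Proof.
have dWx := diff_derivable (v := w) (dW x).
have EZ : 'D_w (fun y => 2^-1 *: W y) x = 2^-1 *: 'D_w W x := deriveZ 2^-1 dWx.
have EN : 'D_w (fun y => - (2^-1 *: W y)) x = - 'D_w (fun y => 2^-1 *: W y) x :=
  deriveN (derivableZ (k := 2^-1) dWx).
apply: (etrans EN); rewrite EZ; congr (- (_ *: _)).
apply: etrans (derive_mulmx _ (dNtTOm x) (dNt x)) _; apply: (congr2 +%R) => //.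
rewrite -mulmxDl; congr (_ *m _).
apply: etrans (derive_mulmx _ (differentiable_trmx (dNt x)) (dOm x)) _.
by rewrite (derive_trmx _ (dNt x)).
Qed.

Let derive_N x : 'D_w N x = 'D_w L x *m A x + L x *m 'D_w A x + 'D_w Nt x.
Proof.
apply: etrans (deriveD (diff_derivable (dLA x)) (diff_derivable (dNt x))) _.
by apply: (congr2 +%R) => //; exact: derive_mulmx (differentiable_Lframe x) (dA x).
Qed.

Let L_Nt x : (L x)^T *m Om x *m Nt x = - 1%:M.
Proof.
have OmJ : Om x *m Jmx a G (P x) = - G (P x).
  by rewrite /Jmx mulmxN mulmxA mulmxV ?mul1mx//; exact/unit_Om/P_in_M.
rewrite [Nt x]/(Jmx a G (P x) *m L x *m B x) !mulmxA -[_ *m Om x *m _]mulmxA OmJ.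
rewrite mulmxN !mulNmx; congr (- _); exact: mulmxV (unit_gram x).
Qed.

Let L_Nt_flow x : ('D_w L x)^T *m Om x *m Nt x + (L x)^T *m 'D_w Om x *m Nt x
  + (L x)^T *m Om x *m 'D_w Nt x = 0.
Proof.
have dLT := differentiable_trmx (differentiable_Lframe x).
have E : (fun x => (L x)^T *m Om x *m Nt x) = cst (- 1%:M).
  by apply/funext => y; exact: L_Nt.
have := derive_cst (- 1%:M : 'M[R]_n) x w; rewrite -E => <-.
apply/esym; apply: etrans (derive_mulmx _ (differentiable_mulmx dLT (dOm x)) (dNt x)) _.
apply: (congr2 +%R) => //; rewrite -mulmxDl; congr (_ *m _).
apply: etrans (derive_mulmx _ dLT (dOm x)) _.
by rewrite (derive_trmx _ (differentiable_Lframe x)).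
Qed.

Let T x := Th a G h (P x) (dsubmx x).

(** The terms [J' L B] and [J S L B] of the derivative of [J L B] are those that
[T_h] subtracts from [S]. *)
Let Nt_flow x : Om x *m 'D_w Nt x = Om x *m S x *m Nt x - T x *m Nt x
  + Om x *m Nt x *m (invmx (B x) *m 'D_w B x).
Proof.
set J := Jmx a G (P x); pose J' := 'D_(Zh a h (P x) (dsubmx x)) (Jmx a G) (P x).
have NtE : Nt x = J *m L x *m B x by [].
have J'E : 'D_w (fun x => Jmx a G (P x)) x = J'.
  by rewrite /J' -derive_torus_flow; exact: derive_comp (dP x) (dJ (P_in_M x)).
have Nt'E : 'D_w Nt x = (J' *m L x + J *m (S x *m L x)) *m B x + J *m L x *m 'D_w B x.
  apply: etrans (derive_mulmx _ (dJL x) (dB x)) _.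
  apply: (congr2 +%R); last by [].
  congr (_ *m _); apply: etrans (derive_mulmx _ (dJP x) (differentiable_Lframe x)) _.
  by rewrite J'E derive_Lframe_flow.
have TE : T x = Om x *m (S x - J' *m invmx J - J *m S x *m invmx J) by [].
have JV X : X *m invmx J *m Nt x = X *m L x *m B x :> 'M[R]_(2 * n, n).
  rewrite -[Nt x]/(J *m L x *m B x) !mulmxA; congr (_ *m _ *m _).
  exact: mulmxKV (unit_J (P_in_M x)) _.
have BC : Nt x *m (invmx (B x) *m 'D_w B x) = J *m L x *m 'D_w B x.
  by rewrite NtE mulmxA mulmxK//; exact: unit_B.
rewrite -[Om x *m S x *m _]mulmxA -[Om x *m Nt x *m _]mulmxA BC TE -mulmxA -mulmxBr -mulmxDr.
congr (_ *m _); rewrite Nt'E !mulmxBl !JV mulmxDl !mulmxA.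
have sub3 (X Y Z : 'M[R]_(2 * n, n)) : Y + Z = X - (X - Y - Z).
  by apply/matrixP => i j; rewrite !mxE; ring.
by apply: (congr2 +%R); [exact: sub3|].
Qed.

Lemma torsion_at x :
  torsion a G K h omega alpha (usubmx x) (dsubmx x) =
  - (2^-1 *: ((Nt x)^T *m (T x + (T x)^T) *m Nt x))
  + (Nt x)^T *m (T x)^T *m N x + (N x)^T *m T x *m Nt x.
Proof.
have dNx : differentiable (uncurry_cV (Nframe a G K)) (col_mx (usubmx x) (dsubmx x)).
  by rewrite vsubmxK; exact: dN.
rewrite /torsion (LopE _ _ dNx) vsubmxK -/w.
rewrite -[LHS]/((N x)^T *m Om x *m (S x *m N x - 'D_w N x)) derive_N.
exact: torsion_algebra (Omega_antisym a (P x)) (derive_Omega_flow x)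
  (derive_Lframe_flow x) (invariant_torus_isotropic x) (L_Nt x) (L_Nt_flow x)
  (Nt_flow x) (erefl _) (derive_A x).
Qed.

End InvariantTorus.

Theorem lemmaB1 (R : realType) (n l : nat)
  (M : set 'cV[R]_(2 * n))
  (a : 'cV[R]_(2 * n) -> 'cV[R]_(2 * n))
  (G : 'cV[R]_(2 * n) -> 'M[R]_(2 * n))
  (h : 'cV[R]_(2 * n) -> 'cV[R]_l -> R)
  (K : 'cV[R]_n -> 'cV[R]_l -> 'cV[R]_(2 * n))
  (omega : 'cV[R]_n) (alpha : 'cV[R]_l)
  (M_open : open M)
  (symplectic : analytic_exact_symplectic M a)
  (metric : analytic_metric M G)
  (h_torus : forall z, M z -> torus_fun (h z))
  (h_analytic :
    analytic_on [set w : 'cV[R]_(2 * n + l) | M (usubmx w)] (uncurry_cV h))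
  (K_torus_theta : forall phi, torus_fun (K^~ phi))
  (K_torus_phi : forall theta, torus_fun (K theta))
  (K_in_M : forall theta phi, M (K theta phi))
  (K_analytic : mx_analytic_on setT (uncurry_cV K))
  (L_rank : forall theta phi, \rank (Lframe K theta phi) = n)
  (freq_nonresonant : nonresonant omega alpha)
  (K_invariant : forall theta phi,
    Zh a h (K theta phi) phi = - Lop omega alpha K theta phi) :
  forall theta phi,
    let N := Nframe a G K theta phi in
    let Nt := Ntilde a G K theta phi in
    let T_h := Th a G h (K theta phi) phi in
    torsion a G K h omega alpha theta phi =
      - (2^-1 *: (Nt^T *m (T_h + T_h^T) *m Nt))
      + Nt^T *m T_h^T *m N + N^T *m T_h *m Nt.
Proof.
move=> theta phi N Nt T_h.
have [a_smooth _ nondeg] := symplectic; have [G_an _ G_pos] := metric.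
have h_C2 p : Ck_on 2 M (h^~ p).
  have := Ck_on_slice p (analytic_on_Ck 2 h_analytic).
  have -> : [set z | [set w : 'cV[R]_(2 * n + l) | M (usubmx w)] (col_mx z p)] = M.
    by apply/seteqP; split=> z /=; rewrite col_mxKu.
  have -> // : (fun z => uncurry_cV h (col_mx z p)) = h^~ p.
  by apply/funext => z; rewrite /uncurry_cV col_mxKu col_mxKd.
have := torsion_at M_open (fun i => a_smooth i 2%N) nondeg h_C2 K_in_M
  (fun i => analytic_on_Ck 2 (K_analytic i 0)) K_invariant freq_nonresonant
  K_torus_theta K_torus_phi (fun i j => analytic_on_Ck 1 (G_an i j)) G_pos L_rank
  (col_mx theta phi).
by rewrite /uncurry_cV col_mxKu col_mxKd.
Qed.
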